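(* Let $\Omega, a, b, c, g, \theta$ be as specified in the context, with $-1<\theta<0$, $b\ge 0$ and $c\ge 0$ a.e. in $\Omega$, and $g>g_0$ on $\partial\Omega$, where $g_0$ is a positivity threshold (defined in the context). Define $\Psi_0\in H^1(\Omega)$ as the weak solution of $$-\nabla\cdot a\nabla\Psi_0+b\Psi_0=0\ \text{ in }\Omega,\qquad \Psi_0=g^{\frac{2}{1+\theta}}\ \text{ on }\partial\Omega,$$ and, for $n\ge1$, $\Psi_n\in H^1(\Omega)$ as the weak solution of the linear problem $$-\nabla\cdot a\nabla\Psi_n+b\Psi_n+c\,\Psi_{n-1}^{-(\theta+1)}\Psi_n=0\ \text{ in }\Omega,\qquad \Psi_n=g^{\frac{2}{1+\theta}}\ \text{ on }\partial\Omega .$$ Then the sequence $\{\Psi_n\}_{n\ge0}$ converges to the unique positive weak solution $\Psi$ of $$\nabla\cdot a\nabla\Psi = b\,\Psi + c\,|\Psi|^{-(1+\theta)}\Psi \ \text{ in }\Omega,\qquad \Psi = g^{\frac{2}{1+\theta}}\ \text{ on }\partial\Omega .$$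
   Context: Setting: $d\in\{2,3\}$; $\Omega\subset\mathbb{R}^d$ is a bounded, simply connected domain with $C^2$ boundary. $K_0,K_1$ are positive constants. $a\in C^{0,1}(\overline\Omega)$ (a diffusion coefficient), $\sigma_{x,a}\in L^\infty(\Omega)$ and $g\in C^1(\overline\Omega)$ (only its restriction to $\partial\Omega$ is used as boundary datum) satisfy $K_0<a,\sigma_{x,a},g<K_1$. $\theta\in\mathbb{R}\setminus\{-1\}$ and $\mu\in\mathbb{R}$ are constants, $b:=-\frac{2}{1+\theta}\mu\,\sigma_{x,a}$, and $c\in L^\infty(\Omega)$ is real-valued. Weak solution of the semilinear problem: $\Psi\in H^1(\Omega)$ with trace $g^{2/(1+\theta)}$ such that, for every $\phi\in H^1_0(\Omega)$, $(b\Psi+c|\Psi|^{-(1+\theta)}\Psi)\phi$ is integrable and $\int_\Omega a\nabla\Psi\cdot\nabla\phi\,d\mathbf{x} = -\int_\Omega (b\Psi+c|\Psi|^{-(1+\theta)}\Psi)\phi\,d\mathbf{x}$ (with $|z|^{-(1+\theta)}z:=0$ at $z=0$ when $\theta<0$). Positive means $\Psi>0$ a.e. in $\Omega$. Positivity threshold: a constant $g_0>0$, depending on $\Omega,a,b,c,\theta$ but not on $g$, such that for every boundary datum $\tilde g$ (restriction to $\partial\Omega$ of a positive $C^1(\overline\Omega)$ function) with $\tilde g>g_0$ on $\partial\Omega$, the unique non-negative weak solution of the semilinear problem with boundary value $\tilde g^{2/(1+\theta)}$ is positive a.e. in $\Omega$. *)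

(* Defs.v *)
From HB Require Import structures.
From mathcomp Require Import all_boot all_order all_algebra.
From mathcomp Require Import all_classical all_reals all_analysis.

Set Implicit Arguments.
Unset Strict Implicit.
Unset Printing Implicit Defensive.

Import Order.TTheory GRing.Theory Num.Theory.
Import numFieldNormedType.Exports.

Local Open Scope classical_set_scope.
Local Open Scope ring_scope.

(* Product sigma-algebra on ['rV[R]_n]: the one generated by the coordinates,
   as the library does for [n.-tuple T]. *)
Definition rV_display : measure_display.
Proof. exact: default_measure_display. Qed.

Section rV_measurable.
Context {R : realType} {n : nat}.

Definition rV_coord (i : 'I_n) (x : 'rV[R]_n) : measurableTypeR R := x 0 i.

Let rV_set0 : g_sigma_preimage rV_coord set0.
Proof. exact: sigma_algebra0. Qed.

Let rV_setC A : g_sigma_preimage rV_coord A -> g_sigma_preimage rV_coord (~` A).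
Proof. exact: sigma_algebraC. Qed.

Let rV_bigcup (F : _^nat) : (forall i, g_sigma_preimage rV_coord (F i)) ->
  g_sigma_preimage rV_coord (\bigcup_i (F i)).
Proof. exact: sigma_algebra_bigcup. Qed.

HB.instance Definition _ := @isMeasurable.Build rV_display
  'rV[R]_n (g_sigma_preimage rV_coord) rV_set0 rV_setC rV_bigcup.

End rV_measurable.

Section rV_measurable_maps.
Context {R : realType}.

Lemma measurable_rV_coord n (i : 'I_n) :
  measurable_fun [set: 'rV[R]_n] (rV_coord i).
Proof.
move=> _ Y mY; rewrite setTI; apply: sub_sigma_algebra => /=.
rewrite -bigcup_seq/=; exists i => /=; first by rewrite mem_index_enum.
by exists Y => //; rewrite setTI.
Qed.

Lemma measurable_fun_rVP d (T : measurableType d) n (f : T -> 'rV[R]_n) :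
  (forall i, measurable_fun [set: T] (rV_coord i \o f)) ->
  measurable_fun [set: T] f.
Proof.
move=> mf _ A mA; rewrite setTI.
suff : g_sigma_preimage (@rV_coord R n) `<=` [set B | measurable (f @^-1` B)].
  exact.
apply: smallest_sub.
  split=> /=.
  - by rewrite preimage_set0.
  - by move=> B mB; rewrite setTD preimage_setC; exact: measurableC.
  - by move=> F mF; rewrite preimage_bigcup; exact: bigcup_measurable.
rewrite -bigcup_seq; apply: bigcup_sub => i _ _ [B mB <-] /=.
by rewrite setTI -[X in measurable X]setTI; exact: mf.
Qed.

Definition cons_rV n (p : measurableTypeR R * 'rV[R]_n) : 'rV[R]_n.+1 :=
  \row_i oapp (fun j => p.2 0 j) p.1 (unlift ord0 i).

Definition uncons_rV n (x : 'rV[R]_n.+1) : measurableTypeR R * 'rV[R]_n :=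
  (x 0 ord0, \row_j x 0 (lift ord0 j)).

Lemma cons_rV0 n (p : measurableTypeR R * 'rV[R]_n) : cons_rV p 0 ord0 = p.1.
Proof. by rewrite mxE unlift_none. Qed.

Lemma cons_rVS n (p : measurableTypeR R * 'rV[R]_n) (j : 'I_n) :
  cons_rV p 0 (lift ord0 j) = p.2 0 j.
Proof. by rewrite mxE liftK. Qed.

Lemma cons_rVK n : cancel (@cons_rV n) (@uncons_rV n).
Proof.
move=> [x v]; rewrite /uncons_rV cons_rV0; congr pair.
by apply/rowP => j; rewrite mxE cons_rVS.
Qed.

Lemma measurable_cons_rV n : measurable_fun setT (@cons_rV n).
Proof.
apply: measurable_fun_rVP => i.
case: (unliftP ord0 i) => [j|] ->.
  rewrite (_ : _ \o _ = rV_coord j \o snd).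
    exact: measurableT_comp (measurable_rV_coord j) measurable_snd.
  by apply/funext => p; exact: cons_rVS.
rewrite (_ : _ \o _ = fst) //.
by apply/funext => p; exact: cons_rV0.
Qed.

Lemma measurable_uncons_rV n : measurable_fun setT (@uncons_rV n).
Proof.
apply: measurable_fun_pair; first exact: measurable_rV_coord.
apply: measurable_fun_rVP => j.
rewrite (_ : _ \o _ = rV_coord (lift ord0 j)); first exact: measurable_rV_coord.
by apply/funext => x; rewrite /rV_coord /= mxE.
Qed.

End rV_measurable_maps.

Section lebesgue_rV.
Context {R : realType}.

Section step.
Variables (n : nat) (mu : {sigma_finite_measure set 'rV[R]_n -> \bar R}).

Definition lebesgue_rVS : set 'rV[R]_n.+1 -> \bar R :=
  pushforward (@lebesgue_measure R \x mu)%E (@cons_rV R n).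

Let lebesgue_rVS0 : lebesgue_rVS set0 = 0%E.
Proof. by rewrite /lebesgue_rVS /pushforward preimage_set0 measure0. Qed.

Let lebesgue_rVS_ge0 A : (0 <= lebesgue_rVS A)%E.
Proof. by rewrite /lebesgue_rVS /pushforward; exact: measure_ge0. Qed.

Let lebesgue_rVS_sigma_additive : semi_sigma_additive lebesgue_rVS.
Proof.
exact: (@measure_semi_sigma_additive _ _ _
  (measure_function_pushforward__canonical__measure_function_Measure
     (lebesgue_measure \x mu)%E (@measurable_cons_rV R n))).
Qed.

HB.instance Definition _ := isMeasure.Build _ _ _ lebesgue_rVS
  lebesgue_rVS0 lebesgue_rVS_ge0 lebesgue_rVS_sigma_additive.

Let lebesgue_rVS_sigma_finite : sigma_finite setT lebesgue_rVS.
Proof.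
have /sigma_finiteP[F [TF ndF Foo]] := sigma_finiteT (@lebesgue_measure R).
have /sigma_finiteP[G [TG ndG Goo]] := sigma_finiteT mu.
exists (fun k => @uncons_rV R n @^-1` (F k `*` G k)).
  rewrite -preimage_bigcup (_ : \bigcup_k _ = setT) ?preimage_setT//.
  rewrite -setXTT TF TG predeqE => -[x y]; split.
    by move=> [k _ []/= ? ?]; split; exists k.
  move=> [/= [i _ Fix_] [j _ Gjy]]; exists (maxn i j) => //; split.
  - by move: x Fix_; exact/subsetPset/ndF/leq_maxl.
  - by move: y Gjy; exact/subsetPset/ndG/leq_maxr.
move=> k; have [mF Fk] := Foo k; have [mG Gk] := Goo k; split.
  rewrite -[X in measurable X]setTI; apply: measurable_uncons_rV => //.
  exact: measurableX.
rewrite /lebesgue_rVS /pushforward -comp_preimage.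
rewrite (_ : _ \o _ = id); last by apply/funext => p; exact: cons_rVK.
by rewrite preimage_id product_measure1E// lte_mul_pinfty// ge0_fin_numE.
Qed.

HB.instance Definition _ := Measure_isSigmaFinite.Build _ _ _ lebesgue_rVS
  lebesgue_rVS_sigma_finite.

End step.

(* Lebesgue measure on [R^n]: the n-fold product of the one-dimensional one. *)
Fixpoint lebesgue_rV (n : nat) : {sigma_finite_measure set 'rV[R]_n -> \bar R} :=
  match n with
  | 0 => [the {sigma_finite_measure set 'rV[R]_0 -> \bar R} of \d_(0 : 'rV[R]_0)]
  | m.+1 => lebesgue_rVS (lebesgue_rV m)
  end.

End lebesgue_rV.

Section sobolev.
Context {R : realType} {n : nat}.
Local Notation leb := (@lebesgue_rV R n).
Implicit Types (Omega : set 'rV[R]_n) (f u h phi : 'rV[R]_n -> R).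

Definition partial (i : 'I_n) f : 'rV[R]_n -> R :=
  fun x => 'D_('e_i : 'rV[R]_n) f x.

(* [f] is of class [C^k] on the whole space. *)
Fixpoint Ck (k : nat) f : Prop :=
  match k with
  | 0 => continuous f
  | m.+1 => continuous f /\ forall i : 'I_n,
      (forall x, derivable f x ('e_i : 'rV[R]_n)) /\ Ck m (partial i f)
  end.

(* [C^1] up to the boundary, for an open [Omega]: the partial derivatives, taken
   inside [Omega], extend continuously to the closure. *)
Definition C1_closure Omega f : Prop :=
  {within closure Omega, continuous f} /\
  forall i : 'I_n, exists2 F : 'rV[R]_n -> R,
    {within closure Omega, continuous F} &
    forall x, Omega x ->
      derivable f x ('e_i : 'rV[R]_n) /\ partial i f x = F x.

Definition test_function Omega phi : Prop :=
  (forall k, Ck k phi) /\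
  exists K : set 'rV[R]_n,
    [/\ compact K, K `<=` Omega & forall x, ~ K x -> phi x = 0].

Definition in_Lp Omega (p : \bar R) f : Prop := f \_ Omega \in Lfun leb p.

Definition L2norm Omega f : \bar R := 'N[leb]_2%:E[EFin \o (f \_ Omega)]%E.

(* An element of [H^1(Omega)] is a square-integrable function together with a
   square-integrable weak gradient.  The gradient is determined by the function
   up to a null set, so carrying a representative of it is harmless. *)
Record H1 Omega := MkH1 {
  H1val :> 'rV[R]_n -> R;
  grad : 'I_n -> 'rV[R]_n -> R;
  H1val_L2 : in_Lp Omega 2%:E H1val;
  grad_L2 : forall i, in_Lp Omega 2%:E (grad i);
  grad_weak : forall i phi, test_function Omega phi ->
    \int[leb]_(x in Omega) (H1val x * partial i phi x) =
    - \int[leb]_(x in Omega) (grad i x * phi x)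
}.

Definition H1sqnorm Omega u (Du : 'I_n -> 'rV[R]_n -> R) : \bar R :=
  (L2norm Omega u ^+ 2 + \sum_(i < n) L2norm Omega (Du i) ^+ 2)%E.

Definition H1_cvg Omega (u_ : nat -> H1 Omega) (u : H1 Omega) : Prop :=
  (fun k => H1sqnorm Omega (u_ k \- u) (fun i => grad (u_ k) i \- grad u i))
    @ \oo --> 0%E.

(* The pair [(u, Du)] is in the [H^1]-closure of the test functions. *)
Definition H10 Omega u (Du : 'I_n -> 'rV[R]_n -> R) : Prop :=
  exists phi : nat -> 'rV[R]_n -> R,
    (forall k, test_function Omega (phi k)) /\
    (fun k => H1sqnorm Omega (u \- phi k) (fun i => Du i \- partial i (phi k)))
      @ \oo --> 0%E.

(* [u = h] on the boundary in the sense of traces, for [h] of class [C^1] up to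
   the boundary: [u - h] belongs to [H^1_0(Omega)]. *)
Definition has_trace Omega h (u : H1 Omega) : Prop :=
  H10 Omega (u \- h) (fun i => grad u i \- partial i h).

(* Weak solution of [- div (a grad u) + F = 0] in [Omega], [u = h] on the
   boundary.  [F] is instantiated by terms that involve [u] itself. *)
Definition weak_solution Omega (a F h : 'rV[R]_n -> R) (u : H1 Omega) : Prop :=
  has_trace h u /\
  forall phi : H1 Omega, H10 Omega phi (grad phi) ->
    leb.-integrable Omega (EFin \o (F \* phi)) /\
    \int[leb]_(x in Omega) (a x * \sum_(i < n) grad u i x * grad phi i x) =
    - \int[leb]_(x in Omega) (F x * phi x).

Definition nonneg_ae Omega f : Prop := \forall x \ae leb, Omega x -> 0 <= f x.
Definition pos_ae Omega f : Prop := \forall x \ae leb, Omega x -> 0 < f x.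

(* [u] is the only element of [H^1(Omega)] satisfying [P]. *)
Definition unique_H1 Omega (P : H1 Omega -> Prop) (u : H1 Omega) : Prop :=
  P u /\ forall v : H1 Omega, P v -> \forall x \ae leb, Omega x -> v x = u x.

End sobolev.

Arguments H10 {R n} Omega u Du.

Section domains.
Context {R : realType} {n : nat}.
Implicit Types (Omega : set 'rV[R]_n).

Definition domain Omega : Prop :=
  [/\ open Omega, connected Omega & Omega !=set0].

(* Path-connected, and every loop contracts to its base point inside [Omega]. *)
Definition simply_connected Omega : Prop :=
  (forall x y, Omega x -> Omega y ->
     exists p : R -> 'rV[R]_n,
       [/\ {within [set` `[0, 1]%R], continuous p}, p 0 = x, p 1 = y
         & forall t, 0 <= t <= 1 -> Omega (p t)]) /\
  (forall p : R -> 'rV[R]_n,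
     {within [set` `[0, 1]%R], continuous p} -> p 0 = p 1 ->
     (forall t, 0 <= t <= 1 -> Omega (p t)) ->
     exists H : R * R -> 'rV[R]_n,
       [/\ {within [set` `[0, 1]%R] `*` [set` `[0, 1]%R], continuous H},
           forall s t, 0 <= s <= 1 -> 0 <= t <= 1 -> Omega (H (s, t)),
           forall t, 0 <= t <= 1 -> H (0, t) = p t /\ H (1, t) = p 0
         & forall s, 0 <= s <= 1 -> H (s, 0) = p 0 /\ H (s, 1) = p 0]).

(* The topological boundary, for an open [Omega]. *)
Definition boundary Omega : set 'rV[R]_n := closure Omega `\` Omega.

(* Near each boundary point, up to relabelling and reorienting the axes, [Omega]
   is the region above the graph of a [C^2] function of the [n - 1] coordinates
   other than the [i]-th. *)
Definition C2_boundary Omega : Prop :=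
  forall x0, boundary Omega x0 ->
    exists (r : R) (i : 'I_n) (s : bool) (gamma : 'rV[R]_n.-1 -> R),
      [/\ 0 < r, Ck 2 gamma
        & forall x, ball x0 r x ->
            (Omega x <-> gamma (col' i x) < (-1) ^+ s * x 0 i)].

End domains.

Section semilinear.
Context {R : realType} {n : nat}.
Implicit Types (Omega : set 'rV[R]_n) (a b c g u w : 'rV[R]_n -> R).

Definition b_coef (theta mu : R) (sigma : 'rV[R]_n -> R) : 'rV[R]_n -> R :=
  fun x => - (2 / (1 + theta)) * mu * sigma x.

Definition boundary_data (theta : R) g : 'rV[R]_n -> R :=
  fun x => g x `^ (2 / (1 + theta)).

(* The product vanishes where [u] does, whatever the value of the power. *)
Definition semilinear_term (theta : R) b c u : 'rV[R]_n -> R :=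
  fun x => b x * u x + c x * (`|u x| `^ (- (1 + theta)) * u x).

Definition linearized_term (theta : R) b c w u : 'rV[R]_n -> R :=
  fun x => b x * u x + c x * w x `^ (- (theta + 1)) * u x.

Definition semilinear_solution Omega (theta : R) a b c g (u : H1 Omega) : Prop :=
  weak_solution a (semilinear_term theta b c u) (boundary_data theta g) u.

Definition positivity_threshold Omega (theta : R) a b c (g0 : R) : Prop :=
  0 < g0 /\
  forall g, C1_closure Omega g -> (forall x, closure Omega x -> 0 < g x) ->
    (forall x, boundary Omega x -> g0 < g x) ->
    exists Psi : H1 Omega,
      unique_H1 (fun u : H1 Omega =>
        semilinear_solution theta a b c g u /\ nonneg_ae Omega u) Psi /\
      pos_ae Omega Psi.

End semilinear.

(* Main.v *)
Require Import Defs.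
From HB Require Import structures.
From mathcomp Require Import all_boot all_order all_algebra.
From mathcomp Require Import all_classical all_reals all_analysis.
From mathcomp Require Import measurable_realfun ess_sup_inf.
From mathcomp Require Import ring lra.

Set Implicit Arguments.
Unset Strict Implicit.
Unset Printing Implicit Defensive.

Import Order.TTheory GRing.Theory Num.Theory.
Import numFieldNormedType.Exports.

Local Open Scope classical_set_scope.
Local Open Scope ring_scope.

(* The iterates decrease and stay above the positive solution [Psi] provided by
   the threshold: comparing two solutions amounts to testing the difference of
   their equations with [(u - v)^+] and using Poincare's inequality, and a larger
   [Psi_(n-1)] means a smaller coefficient [Psi_(n-1)^-(1+theta)], hence a larger
   [Psi_n].  Put [w_n = Psi_n - Psi].  Testing the difference of the equations of
   [Psi_n] and [Psi] with [w_n], the reaction terms split into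
   [b w_n^2 >= 0], into [c (Psi_n^(-theta) - Psi^(-theta)) w_n >= 0] (as
   [-theta > 0]), and into a remainder with factor
   [Psi_n^-(1+theta) - Psi_(n-1)^-(1+theta)].  For almost every [x] this factor
   tends to [0], being the increment of a monotone sequence bounded by
   [Psi^-(1+theta)], and the remainder is dominated by [||c||_oo (1 + 2 Psi_0^2)].
   So [int a |grad w_n|^2] tends to [0], and [w_n] tends to [0] in [H^1] by
   Poincare.  The limit of the iterates is never constructed.

   Positive parts are kept in [H^1_0] by approximating [t^+] with the smooth
   functions [(ln (1 + e^(k t)) - ln 2) / k], which map test functions to test
   functions; Poincare's inequality and the weak gradients of elements of [H^1_0]
   come from [int d_i eta = 0] for test functions [eta]. *)

(** * Borel sets and bounded sets of row vectors *)

Section euclidean_measure.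
Context {R : realType}.

Lemma ler_norm_coord n (x : 'rV[R]_n) (i : 'I_n) : `|x 0 i| <= `|x|.
Proof.
have /mapP[j Hj ->] : `|x 0 i| \in [seq `|x k.1 k.2| | k : 'I_1 * 'I_n].
  by apply/mapP; exists (ord0, i) => //=; rewrite mem_enum.
by rewrite [leRHS]/Num.Def.normr /= mx_normrE; apply/bigmax_geP; right => /=; exists j.
Qed.

(** The sigma-algebra is generated by the coordinates, so it contains boxes; an open set is the
    union of the countably many boxes with rational centre and radius [1 / (k + 1)] that it
    contains. *)
Lemma open_measurable_rV n (U : set 'rV[R]_n) : open U -> measurable U.
Proof.
move=> oU.
pose box (p : 'rV[rat]_n * nat) : set 'rV[R]_n :=
  [set x | forall i, ball (ratr (p.1 0 i) : R) p.2.+1%:R^-1 (x 0 i)].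
have mbox p : measurable (box p).
  have -> : box p = \big[setI/setT]_(i < n)
      (rV_coord i @^-1` ball (ratr (p.1 0 i) : R) p.2.+1%:R^-1).
    rewrite -bigcap_seq; apply/seteqP; split => x.
      by move=> px i _; exact: px.
    by move=> px i; apply: px => /=; rewrite mem_index_enum.
  apply: bigsetI_measurable => i _; rewrite -[X in measurable X]setTI.
  apply: measurable_rV_coord => //.
  by apply: open_measurable; exact: ball_open.
(* An enumeration of these boxes by codes of pairs; codes of no pair and boxes not inside [U]
   contribute the empty set. *)
pose F k := if unpickle k is Some p then
  (if `[< box p `<=` U >] then box p else set0) else set0.
have -> : U = \bigcup_k F k.
  apply/seteqP; split => [x Ux|x [k _]]; last first.
    rewrite /F; case: unpickle => // p; case: asboolP => // pU; exact: pU.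
  have /nbhs_ballP[e /= e0 xeU] := open_nbhs_nbhs (conj oU Ux).
  (* With a radius below [e / 2], a box that contains [x] stays within distance [e] of [x]. *)
  have [k ke] : exists k : nat, k.+1%:R^-1 < e / 2.
    have e20 : 0 < e / 2 by rewrite divr_gt0.
    have [k _ /(_ k (leqnn k))] := near_infty_natSinv_lt (PosNum e20).
    by exists k.
  have /choice[q xq] : forall i, exists q : rat,
      ball (ratr q : R) k.+1%:R^-1 (x 0 i).
    move=> i.
    have : x 0 i - k.+1%:R^-1 < x 0 i + k.+1%:R^-1.
      by rewrite ltrBlDr -addrA ltrDl addr_gt0.
    move=> /rat_in_itvoo[q]; rewrite in_itv/= => /andP[q1 q2]; exists q.
    by rewrite /ball/= ltr_distl q1 q2.
  exists (pickle (\row_i q i, k)) => //.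
  rewrite /F pickleK; case: asboolP => [_ i /=|]; first by rewrite mxE.
  case=> y /= yq; apply: xeU; split => // i j; rewrite !ord1.
  have := yq j; have := xq j; rewrite !mxE /ball/= => A B.
  have -> : x 0 j - y 0 j = (ratr (q j) - y 0 j) - (ratr (q j) - x 0 j).
    by ring.
  rewrite (le_lt_trans (ler_normB _ _))// (splitr e) ltrD ?(lt_trans _ ke)//.
apply: bigcupT_measurable => k; rewrite /F; case: unpickle => // p.
by case: asboolP.
Qed.

Lemma open_continuous_measurable_rV n (D : set 'rV[R]_n) (f : 'rV[R]_n -> R) :
  open D -> {in D, continuous f} -> measurable_fun D f.
Proof.
move=> oD; rewrite -(continuous_open_subspace f oD) => /continuousP cf.
apply: (measurability _ (RGenOpens.measurableE R)).
move=> _ [_ [a [b ->] <-]].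
have /cf /open_subspaceP[V oV VD] : open [set` `]a, b[%R].
  exact: interval_open.
rewrite setIC -VD.
by apply: measurableI; exact: open_measurable_rV.
Qed.

Lemma continuous_measurable_rV n (f : 'rV[R]_n -> R) :
  continuous f -> measurable_fun setT f.
Proof.
by move=> cf; apply: open_continuous_measurable_rV => //; exact: openT.
Qed.

Lemma measurable_cube_rV n (M : R) :
  measurable [set x : 'rV[R]_n | forall i, `|x 0 i| <= M].
Proof.
have -> : [set x : 'rV[R]_n | forall i, `|x 0 i| <= M] =
    \big[setI/setT]_(i < n) (rV_coord i @^-1` [set` `[- M, M]]).
  rewrite -bigcap_seq; apply/seteqP; split => x.
    by move=> px i _; rewrite /rV_coord /= in_itv/= -ler_norml; exact: px.
  move=> px i; have := px i; rewrite /rV_coord /= in_itv/= -ler_norml; apply.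
  by rewrite mem_index_enum.
apply: bigsetI_measurable => i _; rewrite -[X in measurable X]setTI.
exact: measurable_rV_coord.
Qed.

(** Induction along the product construction of the measure: in dimension 0 it is a Dirac mass, and
    each step multiplies by the length of an interval. *)
Lemma lebesgue_rV_cube n (M : R) :
  (lebesgue_rV n [set x : 'rV[R]_n | forall i, (`|x 0 i| <= M)%R] < +oo)%E.
Proof.
elim: n => [|n IH].
  by rewrite /= diracE; case: (_ \in _); rewrite ltry.
have -> : lebesgue_rV n.+1 [set x : 'rV[R]_n.+1 | forall i, `|x 0 i| <= M] =
    ((@lebesgue_measure R \x lebesgue_rV n)%E
      ([set` `[- M, M]] `*` [set x : 'rV[R]_n | forall i, `|x 0 i| <= M])).
  rewrite /= /lebesgue_rVS /pushforward; congr (_ _).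
  apply/seteqP; split => -[t v] /=.
    move=> tv; split.
      by have := tv ord0; rewrite cons_rV0 /= in_itv/= ler_norml.
    by move=> i; have := tv (lift ord0 i); rewrite cons_rVS.
  move=> [+ vM] i; rewrite in_itv/= -ler_norml => tM.
  by case: (unliftP ord0 i) => [j|] ->; rewrite ?cons_rVS ?cons_rV0.
have mI : measurable [set` `[- M, M]] by exact: measurable_itv.
rewrite product_measure1E//; last exact: measurable_cube_rV.
have fI : (@lebesgue_measure R [set` `[- M, M]%R] < +oo)%E.
  by rewrite lebesgue_measure_itv/=; case: ifP => // _; rewrite -EFinB ltry.
by rewrite lte_mul_pinfty// ge0_fin_numE.
Qed.

Lemma lebesgue_rV_bounded n (A : set 'rV[R]_n) :
  measurable A -> bounded_set A -> (lebesgue_rV n A < +oo)%E.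
Proof.
move=> mA [M [_ /(_ (M + 1))]]; rewrite ltrDl => /(_ ltr01) AM.
apply: le_lt_trans (lebesgue_rV_cube n (M + 1)).
apply: le_measure; rewrite ?inE//.
  exact: measurable_cube_rV.
by move=> x /AM /= xM i; exact: le_trans (ler_norm_coord x i) xM.
Qed.

End euclidean_measure.

(** * Calculus of C^k functions and test functions *)

Section Ck_calculus.
Context {R : realType} {n : nat}.
Implicit Types (f g : 'rV[R]_n -> R) (G : R -> R).

Lemma derive_line (V W : normedModType R) (f : V -> W) x v :
  'D_v f x = derive1 (fun h : R => f (h *: v + x)) 0.
Proof.
rewrite derive1E /derive; set g1 := fun h => h^-1 *: _; set g2 := fun h => h^-1 *: _.
suff -> : g1 = g2 by [].
by rewrite funeqE /g1 /g2 => h /=; rewrite addr0 scale0r add0r [_%:A]mulr1.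
Qed.

(** Only a directional derivative of [f] is assumed, so the one-variable chain rule is applied to
    the restriction of [f] to the line through [x] in direction [v]. *)
Lemma is_derive_comp1 (V : normedModType R) (f : V -> R) G x v df dG :
  is_derive x v f df -> is_derive (f x) 1 G dG ->
  is_derive x v (G \o f) (dG * df).
Proof.
move=> [df1 dfE] [dG1 dGE].
pose l (h : R) := f (h *: v + x).
have l0 : l 0 = f x by rewrite /l scale0r add0r.
have dl : derivable l 0 1 := (derivable1P f x v).1 df1.
have dGl : derivable G (l 0) 1 := eq_ind_r (fun y => derivable G y 1) dG1 l0.
split.
  apply/(derivable1P (G \o f)).
  apply: (derivable1_diffP (G \o l) 0).2.
  exact: (@differentiable_comp _ _ _ _ l G 0 ((derivable1_diffP l 0).1 dl)
    ((derivable1_diffP G (l 0)).1 dGl)).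
have -> : 'D_v (G \o f) x = derive1 (G \o l) 0 := derive_line (G \o f) x v.
have dGE' : dG = derive1 G (l 0).
  by rewrite derive1E -dGE; exact: (eq_ind_r (fun y => 'D_1 G (f x) = 'D_1 G y) erefl l0).
have dfE' : df = derive1 l 0 by rewrite -dfE; exact: derive_line.
rewrite dGE' dfE'; exact: (@derive1_comp R l G 0 dl dGl).
Qed.

Lemma CkW k f : Ck k.+1 f -> Ck k f.
Proof.
elim: k f => [|k IH] f [cf df]; first exact: cf.
by split => // i; have [df1 df2] := df i; split => //; exact: IH.
Qed.

Lemma Ck_cst k (r : R) : Ck k (cst r : 'rV[R]_n -> R).
Proof.
elim: k r => [|k IH] r; first exact: cst_continuous.
split; first exact: cst_continuous.
move=> i; split; first by move=> x; exact: derivable_cst.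
rewrite (_ : partial i _ = cst 0); first exact: IH.
by apply/funext => x; rewrite /partial derive_cst.
Qed.

Lemma is_derive_coord (i : 'I_n) (x v : 'rV[R]_n) :
  is_derive x v (fun y : 'rV[R]_n => y 0 i) (v 0 i).
Proof.
have E : (fun h : R => h^-1 *: (((fun y : 'rV[R]_n => y 0 i) \o shift x) (h *: v)
    - x 0 i)) @ 0^' --> v 0 i.
  apply: cvg_near_cst; near=> h.
  rewrite /= !mxE addrK /GRing.scale /= mulrA mulVf ?mul1r//.
  by near: h; exact: nbhs_dnbhs_neq.
by split; [apply/cvg_ex; exists (v 0 i)|exact: cvg_lim E].
Unshelve. all: by end_near. Qed.

Lemma Ck_coord k (i : 'I_n) : Ck k (fun x : 'rV[R]_n => x 0 i).
Proof.
case: k => [|k]; first by move=> x; exact: coord_continuous.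
split; first by move=> x; exact: coord_continuous.
move=> j; split; first by move=> x; have [] := is_derive_coord i x 'e_j.
rewrite (_ : partial j _ = cst (('e_j : 'rV[R]_n) 0 i)); first exact: Ck_cst.
by apply/funext => x; rewrite /partial; have [] := is_derive_coord i x 'e_j.
Qed.

Lemma partialD i f g x :
  derivable f x ('e_i : 'rV[R]_n) -> derivable g x ('e_i : 'rV[R]_n) ->
  partial i (f \+ g) x = partial i f x + partial i g x.
Proof. by move=> df dg; rewrite /partial deriveD. Qed.

Lemma partialM i f g x :
  derivable f x ('e_i : 'rV[R]_n) -> derivable g x ('e_i : 'rV[R]_n) ->
  partial i (f \* g) x = f x * partial i g x + g x * partial i f x.
Proof. by move=> df dg; rewrite /partial (deriveM df dg). Qed.

Lemma CkD k f g : Ck k f -> Ck k g -> Ck k (f \+ g).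
Proof.
elim: k f g => [|k IH] f g; first by move=> /= cf cg x; exact: (continuousD (cf x) (cg x)).
move=> [cf df] [cg dg]; split; first by move=> x; exact: (continuousD (cf x) (cg x)).
move=> i; have [df1 df2] := df i; have [dg1 dg2] := dg i; split.
  by move=> x; exact: derivableD.
rewrite (_ : partial i _ = partial i f \+ partial i g); first exact: IH.
by apply/funext => x; rewrite partialD.
Qed.

Lemma CkM k f g : Ck k f -> Ck k g -> Ck k (f \* g).
Proof.
elim: k f g => [|k IH] f g; first by move=> /= cf cg x; exact: (continuousM (cf x) (cg x)).
move=> /[dup] kf [cf df] /[dup] kg [cg dg].
split; first by move=> x; exact: (continuousM (cf x) (cg x)).
move=> i; have [df1 df2] := df i; have [dg1 dg2] := dg i; split.
  by move=> x; exact: derivableM.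
rewrite (_ : partial i _ = (f \* partial i g) \+ (g \* partial i f)).
  by apply: CkD; apply: IH => //; exact: CkW.
by apply/funext => x; rewrite partialM.
Qed.

(** The order [j] is left free because differentiating the composite turns the [j]-th derivative of
    [G] into the next one, to which the induction hypothesis must apply. *)
Lemma Ck_comp k j f G : (forall l x, derivable (derive1n l G) x 1) -> Ck k f ->
  Ck k (derive1n j G \o f).
Proof.
move=> dG; elim: k j => [|k IH] j fk.
  move=> x; apply: continuous_comp; first exact: fk.
  by apply: differentiable_continuous; apply/derivable1_diffP.
move: (fk) => [cf df]; split.
  move=> x; apply: continuous_comp; first exact: cf.
  by apply: differentiable_continuous; apply/derivable1_diffP.
move=> i; have [df1 df2] := df i.
have dGf x := is_derive_comp1 (derivableP (df1 x)) (derivableP (dG j (f x))).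
split; first by move=> x; case: (dGf x).
rewrite (_ : partial i _ = (derive1n j.+1 G \o f) \* partial i f).
  by apply: CkM => //; exact/IH/CkW.
apply/funext => x; case: (dGf x) => _ dE.
by rewrite [LHS]dE -derive1E -derive1nS.
Qed.

End Ck_calculus.

Section test_functions.
Context {R : realType} {n : nat} (Omega : set 'rV[R]_n).
Implicit Types (phi psi f : 'rV[R]_n -> R) (G : R -> R).

Lemma test_derivable phi i x : test_function Omega phi ->
  derivable phi x ('e_i : 'rV[R]_n).
Proof. by move=> [/(_ 1%N)[_ /(_ i)[]]]. Qed.

Lemma test_continuous phi : test_function Omega phi -> continuous phi.
Proof. by move=> [/(_ 0%N)]. Qed.

Lemma test_partial_continuous phi i : test_function Omega phi ->
  continuous (partial i phi).
Proof. by move=> [/(_ 1%N)[_ /(_ i)[_]]]. Qed.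

Lemma test_functionM phi f : test_function Omega phi -> (forall k, Ck k f) ->
  test_function Omega (phi \* f).
Proof.
move=> [sphi [K [cK KO K0]]] sf; split; first by move=> k; exact: CkM.
by exists K; split => // x Kx /=; rewrite K0// mul0r.
Qed.

Lemma test_functionB phi psi : test_function Omega phi ->
  test_function Omega psi -> test_function Omega (phi \- psi).
Proof.
move=> [sphi [K [cK KO K0]]] [spsi [L [cL LO L0]]]; split.
  move=> k; rewrite (_ : _ \- _ = phi \+ (cst (-1) \* psi)).
    by apply: CkD => //; apply: CkM => //; exact: Ck_cst.
  by apply/funext => x /=; rewrite mulN1r.
exists (K `|` L); split; first exact: compactU.
- by rewrite subUset.
- by move=> x /not_orP[Kx Lx] /=; rewrite K0// L0// subr0.
Qed.

Lemma partial_testB phi psi i : test_function Omega phi ->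
  test_function Omega psi ->
  partial i (phi \- psi) = partial i phi \- partial i psi.
Proof.
move=> tphi tpsi; apply/funext => x.
by rewrite /partial (deriveB (test_derivable tphi) (test_derivable tpsi)).
Qed.

Lemma test_function_comp phi G : test_function Omega phi ->
  (forall l x, derivable (derive1n l G) x 1) -> G 0 = 0 ->
  test_function Omega (G \o phi).
Proof.
move=> [sphi [K [cK KO K0]]] dG G0; split.
  by move=> k; rewrite -[G]derive1n0; exact: Ck_comp.
by exists K; split => // x Kx /=; rewrite K0.
Qed.

Lemma partial_comp phi G i : test_function Omega phi ->
  (forall x, derivable G x 1) ->
  partial i (G \o phi) = (derive1 G \o phi) \* partial i phi.
Proof.
move=> tphi dG; apply/funext => x.
have := is_derive_comp1 (derivableP (@test_derivable phi i x tphi)) (derivableP (dG (phi x))).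
by move=> [_ dE]; rewrite [LHS]dE -derive1E.
Qed.

(** The complement of a compact support is open, so the function vanishes near each of its points
    and its derivatives vanish there as well. *)
Lemma test_partial0 phi : test_function Omega phi ->
  exists2 K, compact K /\ K `<=` Omega &
    forall x, ~ K x -> phi x = 0 /\ forall i, partial i phi x = 0.
Proof.
move=> [sphi [K [cK KO K0]]]; exists K => // x Kx; split; first exact: K0.
move=> i; rewrite /partial.
have -> : 'D_('e_i : 'rV[R]_n) phi x = 'D_('e_i : 'rV[R]_n) (cst 0) x.
  apply: near_eq_derive.
  have oK : open (~` K).
    by apply: closed_openC; apply: compact_closed => //; exact: norm_hausdorff.
  have nK : nbhs x (~` K) := open_nbhs_nbhs (conj oK Kx).
  by near=> y; rewrite K0//; near: y.
by rewrite derive_cst.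
Unshelve. all: by end_near. Qed.

End test_functions.

(** * The integral of a compactly supported partial derivative vanishes *)

Section divergence.
Context {R : realType}.

(** Meant for slices of a function: [p] embeds a line or a hyperplane through [cons_rV] and carries
    the direction [w] to [w0]. *)
Lemma derive_comp_affine (V W : normedModType R) (p : V -> W) (f : W -> R)
    (y w : V) (w0 : W) :
  (forall h : R, p (h *: w + y) = h *: w0 + p y) -> derivable f (p y) w0 ->
  derivable (f \o p) y w /\ 'D_w (f \o p) y = 'D_w0 f (p y).
Proof.
move=> pE df.
have E : (fun h : R => (f \o p) (h *: w + y)) = (fun h : R => f (h *: w0 + p y)).
  by apply/funext => h /=; rewrite pE.
split.
  by apply: (derivable1P (f \o p) y w).2; rewrite E; exact: (derivable1P f (p y) w0).1 df.
by rewrite derive_line E -derive_line.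
Qed.

Lemma cons_rV_shift0 n (t h : R) (v : 'rV[R]_n) :
  cons_rV (h *: 1 + t, v) = h *: 'e_ord0 + cons_rV (t, v).
Proof.
apply/rowP => i; rewrite !mxE /=; case: (unliftP ord0 i) => [j|] -> /=.
  by rewrite mulr0 add0r.
by [].
Qed.

Lemma cons_rV_shiftS n (t h : R) (v : 'rV[R]_n) (j : 'I_n) :
  cons_rV (t, h *: 'e_j + v) = h *: 'e_(lift ord0 j) + cons_rV (t, v).
Proof.
apply/rowP => i; rewrite !mxE /=; case: (unliftP ord0 i) => [k|] -> /=.
  by rewrite !mxE (inj_eq (@lift_inj _ ord0)).
by rewrite mulr0 add0r.
Qed.

Lemma nonexpansive_continuous (V W : pseudoMetricType R) (f : V -> W) :
  (forall x y e, 0 < e -> ball x e y -> ball (f x) e (f y)) -> continuous f.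
Proof.
move=> fe x; apply/cvg_ballP => e e0; near=> y; apply: fe => //.
by near: y; exact: nbhsx_ballx.
Unshelve. all: by end_near. Qed.

Lemma ball_cons_rV n (t t' e : R) (v v' : 'rV[R]_n) : 0 < e ->
  ball t e t' -> ball v e v' -> ball (cons_rV (t, v)) e (cons_rV (t', v')).
Proof.
move=> e0 tt' [_ vv']; split => // i j; rewrite !ord1.
by case: (unliftP ord0 j) => [k|] ->; rewrite ?cons_rVS ?cons_rV0.
Qed.

Lemma norm_cons_rV n (t : R) (v : 'rV[R]_n) :
  `|t| <= `|cons_rV (t, v)| /\ `|v| <= `|cons_rV (t, v)|.
Proof.
split; first by have := ler_norm_coord (cons_rV (t, v)) ord0; rewrite cons_rV0.
rewrite [leLHS]/Num.Def.normr /= mx_normrE; apply/bigmax_leP; split => //= -[i j] _ /=.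
by have := ler_norm_coord (cons_rV (t, v)) (lift ord0 j); rewrite cons_rVS ord1.
Qed.

Lemma compact_support_integrable n (f : 'rV[R]_n -> R) (M : R) :
  continuous f -> (forall x, M < `|x| -> f x = 0) ->
  (lebesgue_rV n).-integrable setT (EFin \o f).
Proof.
move=> cf f0; pose A := [set x : 'rV[R]_n | `|x| <= M].
have clA : closed A.
  have -> : A = (fun x : 'rV[R]_n => `|x|) @^-1` [set r | r <= M] by [].
  by apply: closed_comp => [x _|]; [exact: norm_continuous|exact: closed_le].
have bA : bounded_set A.
  exists M; split; first exact: num_real.
  by move=> N MN x /= /le_trans; apply; exact: ltW.
have mA : measurable A.
  by rewrite -[A]setCK; apply: measurableC; apply: open_measurable_rV; exact: closed_openC.
have -> : EFin \o f = (EFin \o f) \_ A.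
  apply/funext => x; rewrite patchE; case: ifPn => // /negP xA /=.
  by rewrite f0// ltNge; apply/negP => xM; apply: xA; rewrite inE.
apply/(integrable_mkcond _ mA).1.
apply: measurable_bounded_integrable => //.
- exact: lebesgue_rV_bounded.
- by apply: measurable_funTS; exact: continuous_measurable_rV.
- have /compact_bounded[N [Nr NP]] : compact (f @` A).
    apply: continuous_compact; last exact: bounded_closed_compact.
    by apply: continuous_subspaceT.
  exists N; split => // y Ny x Ax; apply: NP => //; by exists x.
Qed.

Lemma integral_line_derive (f df : R -> R) (M : R) :
  continuous df -> (forall t : R, is_derive t 1 f (df t)) ->
  (forall t, M < `|t| -> f t = 0) -> (forall t, M < `|t| -> df t = 0) ->
  (\int[lebesgue_measure]_t (df t)%:E = 0)%E.
Proof.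
move=> cdf fdf f0 df0.
(* Positive and larger than [M] whatever the sign of [M], so [f] vanishes at both ends of
   [[- N, N]]. *)
pose N : R := `|M| + 1.
have MN : M < N by rewrite /N ltr_pwDr// ler_norm.
have N0 : 0 < N by rewrite /N ltr_pwDr.
have df1 t : derivable f t 1 by case: (fdf t).
have cf : continuous f.
  by move=> t; apply: differentiable_continuous; apply/derivable1_diffP.
have -> : (\int[lebesgue_measure]_t (df t)%:E =
    \int[lebesgue_measure]_(t in [set` `[- N, N]%R]) (df t)%:E)%E.
  rewrite [RHS]integral_mkcond; apply: eq_integral => t _.
  rewrite patchE; case: ifPn => // /negP tN; congr EFin; apply: df0.
  rewrite (lt_le_trans MN)// leNgt; apply/negP => tN'; apply: tN.
  by rewrite inE /= in_itv/= -ler_norml ltW.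
rewrite (@continuous_FTC2 _ df f)//; first last.
- by move=> t _; rewrite derive1E; case: (fdf t).
- split => //.
  + by apply: cvg_at_right_filter; exact: cf.
  + by apply: cvg_at_left_filter; exact: cf.
- exact: continuous_subspaceT.
- by rewrite (lt_trans _ N0)// oppr_lt0.
have NN : `|N| = N by exact: gtr0_norm.
by rewrite (f0 N) ?NN// (f0 (- N)) ?normrN ?NN// sube0.
Qed.

(** Fubini splits off the first coordinate. The order of integration is chosen so that the inner
    integral is the one containing the direction [i], and this inner integral is already zero. *)
Lemma integral_partial0 n (f : 'rV[R]_n -> R) (i : 'I_n) (M : R) :
  continuous f -> (forall x, derivable f x ('e_i : 'rV[R]_n)) ->
  continuous (partial i f) ->
  (forall x, M < `|x| -> f x = 0) -> (forall x, M < `|x| -> partial i f x = 0) ->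
  (\int[lebesgue_rV n]_x (partial i f x)%:E = 0)%E.
Proof.
elim: n f i => [|n IH] f i; first by case: i.
move=> cf df cdf f0 df0.
pose F (p : measurableTypeR R * 'rV[R]_n) := (partial i f (cons_rV p))%:E.
have mdf : measurable_fun setT (EFin \o partial i f).
  by apply/measurable_EFinP; exact: continuous_measurable_rV.
have iF : ((@lebesgue_measure R) \x lebesgue_rV n)%E.-integrable setT F.
  apply/integrableP; split.
    by apply: (measurableT_comp mdf); exact: measurable_cons_rV.
  have /integrableP[_] := compact_support_integrable cdf df0.
  rewrite /= ge0_integral_pushforward//; first exact: measurable_cons_rV.
  apply/measurable_EFinP; apply: measurableT_comp => //.
  exact: continuous_measurable_rV.
have -> : (\int[lebesgue_rV n.+1]_x (partial i f x)%:E =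
    \int[(@lebesgue_measure R) \x lebesgue_rV n]_p F p)%E.
  by apply: (integral_pushforward (@measurable_cons_rV R n) mdf).
have cons_sndc t : continuous (fun v : 'rV[R]_n => cons_rV (t, v)).
  apply: (@nonexpansive_continuous 'rV[R]_n 'rV[R]_n.+1) => v w e e0.
  by apply: ball_cons_rV => //; exact: ballxx.
have cons_fstc (v : 'rV[R]_n) : continuous (fun t : R => cons_rV (t, v)).
  apply: (@nonexpansive_continuous _ 'rV[R]_n.+1) => t u e e0 tu.
  by apply: ball_cons_rV => //; exact: ballxx.
case: (unliftP ord0 i) => [j|] iE; subst i.
(* A later coordinate: for each fixed first coordinate [t] the slice falls under the induction
   hypothesis. *)
- rewrite -integral12_prod_meas1// /fubini_F.
  rewrite integral0_eq// => t _; rewrite /F.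
  pose ft (v : 'rV[R]_n) := f (cons_rV (t, v)).
  have ftE v : derivable ft v ('e_j : 'rV[R]_n) /\
      partial j ft v = partial (lift ord0 j) f (cons_rV (t, v)).
    apply: derive_comp_affine => [h|]; [exact: cons_rV_shiftS|exact: df].
  have Mt v : M < `|v| -> M < `|cons_rV (t, v)|.
    by move=> /lt_le_trans; apply; case: (norm_cons_rV t v).
  have pE : partial j ft = (fun v => partial (lift ord0 j) f (cons_rV (t, v))).
    by apply/funext => v; case: (ftE v).
  rewrite -[RHS](IH ft j).
  + by rewrite pE.
  + by move=> v; apply: continuous_comp; [exact: cons_sndc|exact: cf].
  + by move=> v; case: (ftE v).
  + by rewrite pE => v; apply: continuous_comp; [exact: cons_sndc|exact: cdf].
  + by move=> v /Mt; exact: f0.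
  + by move=> v /Mt; rewrite pE; exact: df0.
(* The first coordinate: for each fixed [v] the fundamental theorem of calculus is used on a
   line. *)
- rewrite -integral21_prod_meas1// /fubini_G.
  rewrite integral0_eq// => v _; rewrite /F.
  pose fv (t : R) := f (cons_rV (t, v)).
  have fvE t : derivable fv t 1 /\
      'D_1 fv t = partial ord0 f (cons_rV (t, v)).
    apply: (@derive_comp_affine _ _ (fun t : R => cons_rV (t, v))) => [h|].
      exact: cons_rV_shift0.
    exact: df.
  have Mt t : M < `|t| -> M < `|cons_rV (t, v)|.
    by move=> /lt_le_trans; apply; case: (norm_cons_rV t v).
  apply: (@integral_line_derive fv _ M).
  + by move=> t; apply: continuous_comp; [exact: cons_fstc|exact: cdf].
  + by move=> t; case: (fvE t) => ? ?; exact: DeriveDef.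
  + by move=> t /Mt; exact: f0.
  + by move=> t /Mt; exact: df0.
Qed.

End divergence.

(** * Square-integrable functions *)

Lemma poweR_sqr (R : realType) (x : \bar R) : (0 <= x -> x `^ 2 = x ^+ 2)%E.
Proof.
case: x => [r| |//]; first by rewrite lee_fin => r0; rewrite poweR_EFin powR_mulrn.
by move=> _; rewrite poweRyr// expe2 mulyy.
Qed.

Section square_integrable.
Context d (T : measurableType d) (R : realType).
Variables (mu : {measure set T -> \bar R}) (D : set T).
Implicit Types f g : T -> R.

Definition L2 f := measurable_fun D f /\
  mu.-integrable D (EFin \o (fun x => f x ^+ 2)).

(** The squared norm as a real number, open to real arithmetic; to be used together with [L2], since
    an infinite integral is sent to [0]. *)
Definition nsq f : R := \int[mu]_(x in D) (f x ^+ 2).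

Lemma nsq_ge0 f : 0 <= nsq f.
Proof. by apply: Rintegral_ge0 => x _; exact: sqr_ge0. Qed.

Hypothesis mD : measurable D.

Lemma ae_Rintegral_ge0 f : mu.-integrable D (EFin \o f) ->
  (\forall x \ae mu, D x -> 0 <= f x) -> 0 <= \int[mu]_(x in D) f x.
Proof.
move=> fi f0; have mf := measurable_int _ fi.
have mf' : measurable_fun D f by exact/measurable_EFinP.
have -> : \int[mu]_(x in D) f x = \int[mu]_(x in D) `|f x|.
  congr fine; apply: ae_eq_integral => //.
    by apply/measurable_EFinP; exact: measurableT_comp.
  by apply: filterS f0 => x f0 /f0 fx; rewrite ger0_norm.
exact: Rintegral_ge0.
Qed.

Lemma ae_le_Rintegral f g : mu.-integrable D (EFin \o f) ->
  mu.-integrable D (EFin \o g) -> (\forall x \ae mu, D x -> f x <= g x) ->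
  \int[mu]_(x in D) f x <= \int[mu]_(x in D) g x.
Proof.
move=> fi gi fg; rewrite -subr_ge0 -RintegralB//.
apply: ae_Rintegral_ge0; first exact: (integrableB mD gi fi).
by apply: filterS fg => x fg /fg; rewrite subr_ge0.
Qed.

(** A pointwise quadratic bound transfers to integrability and to the norm at once. Three terms are
    what the estimate for [H10_softplus] needs; simpler bounds follow with zero coefficients. *)
Lemma nsq_le3 f g1 g2 g3 (c1 c2 c3 : R) : 0 <= c1 -> 0 <= c2 -> 0 <= c3 ->
  measurable_fun D f -> L2 g1 -> L2 g2 -> L2 g3 ->
  (forall x, D x -> f x ^+ 2 <= c1 * g1 x ^+ 2 + c2 * g2 x ^+ 2 + c3 * g3 x ^+ 2) ->
  L2 f /\ nsq f <= c1 * nsq g1 + c2 * nsq g2 + c3 * nsq g3.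
Proof.
move=> c10 c20 c30 mf [_ i1] [_ i2] [_ i3] fg.
have iZ c g : mu.-integrable D (EFin \o (fun x => g x ^+ 2)) ->
    mu.-integrable D (EFin \o (fun x => c * g x ^+ 2)).
  by move=> ig; have := integrableZl mD c ig; apply: eq_integrable.
have ig12 := integrableD mD (iZ c1 _ i1) (iZ c2 _ i2).
have ig : mu.-integrable D
    (EFin \o (fun x => c1 * g1 x ^+ 2 + c2 * g2 x ^+ 2 + c3 * g3 x ^+ 2)).
  exact: (integrableD mD ig12 (iZ c3 _ i3)).
have fi : mu.-integrable D (EFin \o (fun x => f x ^+ 2)).
  apply: (le_integrable mD _ _ ig).
    by apply/measurable_EFinP; exact: measurable_funX.
  move=> x Dx /=; rewrite lee_fin ger0_norm ?sqr_ge0// (le_trans (fg x Dx))//.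
  exact: ler_norm.
split => //.
rewrite /nsq -!RintegralZl// -RintegralD//; [|exact: iZ..].
rewrite -RintegralD//; [|exact: iZ].
exact: le_Rintegral.
Qed.

Lemma nsq_le f g : measurable_fun D f -> L2 g ->
  (forall x, D x -> `|f x| <= `|g x|) -> L2 f /\ nsq f <= nsq g.
Proof.
move=> mf Lg fg.
have [|Lf nf] := @nsq_le3 f g g g 1 0 0 ler01 (lexx _) (lexx _) mf Lg Lg Lg.
  move=> x Dx; rewrite mul1r !mul0r !addr0 -[leLHS]real_normK ?num_real//.
  by rewrite -[leRHS]real_normK ?num_real// ler_sqr ?nnegrE//; exact: fg.
by split => //; move: nf; rewrite mul1r !mul0r !addr0.
Qed.

Lemma nsqD f g : L2 f -> L2 g ->
  L2 (f \+ g) /\ nsq (f \+ g) <= 2 * nsq f + 2 * nsq g.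
Proof.
move=> Lf Lg.
have [//|//|//|||L n] := @nsq_le3 (f \+ g) f g g 2 2 0 _ _ _ _ Lf Lg Lg.
- by apply: measurable_funD; [case: Lf|case: Lg].
- by move=> x _ /=; rewrite -subr_ge0; have := sqr_ge0 (f x - g x); lra.
by split => //; move: n; rewrite mul0r addr0.
Qed.

Lemma nsqB f g : L2 f -> L2 g ->
  L2 (f \- g) /\ nsq (f \- g) <= 2 * nsq f + 2 * nsq g.
Proof.
move=> Lf Lg.
have [//|//|//|||L n] := @nsq_le3 (f \- g) f g g 2 2 0 _ _ _ _ Lf Lg Lg.
- by apply: measurable_funB; [case: Lf|case: Lg].
- by move=> x _ /=; rewrite -subr_ge0; have := sqr_ge0 (f x + g x); lra.
by split => //; move: n; rewrite mul0r addr0.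
Qed.

Lemma L2_mulb f g (C : R) : measurable_fun D f -> L2 g ->
  (forall x, D x -> `|f x| <= C) -> L2 (f \* g).
Proof.
move=> mf Lg fC.
have [|//|//|||//] := @nsq_le3 (f \* g) g g g (C ^+ 2) 0 0 _ _ _ _ Lg Lg Lg.
- exact: sqr_ge0.
- by apply: measurable_funM => //; case: Lg.
move=> x Dx; rewrite !mul0r !addr0 /= exprMn ler_wpM2r ?sqr_ge0//.
have fxC := fC x Dx; rewrite -(real_normK (num_real (f x))).
by rewrite ler_sqr ?nnegrE// (le_trans _ fxC).
Qed.

Lemma L2_mul_integrable f g : L2 f -> L2 g ->
  mu.-integrable D (EFin \o (f \* g)).
Proof.
move=> [mf fi] [mg gi].
apply: (le_integrable mD _ _ (integrableD mD fi gi)).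
  by apply/measurable_EFinP; exact: measurable_funM.
move=> x Dx /=; rewrite lee_fin [leRHS]ger0_norm ?addr_ge0 ?sqr_ge0//.
rewrite ler_norml; have := sqr_ge0 (f x - g x); have := sqr_ge0 (f x + g x).
by move=> A B; apply/andP; split; nra.
Qed.

(** Young's inequality with a free parameter [e], in the place of Cauchy-Schwarz: no square root of
    [nsq] appears. *)
Lemma L2_mul_le f g (e : R) : 0 < e -> L2 f -> L2 g ->
  `|\int[mu]_(x in D) (f x * g x)| <= nsq f / e + e * nsq g.
Proof.
move=> e0 Lf Lg; have [mf fi] := Lf; have [mg gi] := Lg.
have ifg := L2_mul_integrable Lf Lg.
rewrite (le_trans (le_normr_Rintegral mD ifg))//.
have fi' : mu.-integrable D (EFin \o (fun x => e^-1 * f x ^+ 2)).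
  by have := integrableZl mD e^-1 fi; apply: eq_integrable.
have gi' : mu.-integrable D (EFin \o (fun x => e * g x ^+ 2)).
  by have := integrableZl mD e gi; apply: eq_integrable.
rewrite mulrC /nsq -!RintegralZl// -RintegralD//.
apply: le_Rintegral => //; [exact: integrable_norm|exact: (integrableD mD fi' gi')|].
move=> x Dx /=; set a := f x; set b := g x.
have ei : 0 < e^-1 by rewrite invr_gt0.
have ee : e^-1 * e = 1 by rewrite mulVf// gt_eqF.
have := sqr_ge0 (a - e * b); have := sqr_ge0 (a + e * b).
move=> /(mulr_ge0 (ltW ei)) + /(mulr_ge0 (ltW ei)).
have -> : e^-1 * (a + e * b) ^+ 2 = e^-1 * a ^+ 2 + 2 * (e^-1 * e) * a * b +
  (e^-1 * e) * e * b ^+ 2 by ring.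
have -> : e^-1 * (a - e * b) ^+ 2 = e^-1 * a ^+ 2 - 2 * (e^-1 * e) * a * b +
  (e^-1 * e) * e * b ^+ 2 by ring.
rewrite ee !mulr1 !mul1r.
have := mulr_ge0 (ltW ei) (sqr_ge0 a); have := mulr_ge0 (ltW e0) (sqr_ge0 b).
have -> : 2 * a * b = 2 * (a * b) by ring.
set p := e^-1 * _; set q := e * _; set r := a * b => p0 q0 A B.
by rewrite ler_norml; apply/andP; split; lra.
Qed.

Lemma nsq_dominated (f_ : nat -> T -> R) g : (forall k, measurable_fun D (f_ k)) ->
  L2 g -> (forall x, D x -> f_ k x @[k --> \oo] --> 0) ->
  (forall k x, D x -> `|f_ k x| <= `|g x|) ->
  (forall k, L2 (f_ k)) /\ nsq (f_ k) @[k --> \oo] --> 0.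
Proof.
move=> mf Lg f0 fg; split => [k|]; first by case: (nsq_le (mf k) Lg (fg k)).
have [mg gi] := Lg.
have [|||||_ _] := @dominated_convergence _ T R mu D mD
  (fun k => EFin \o (fun x => f_ k x ^+ 2)) (cst 0%E)
  (EFin \o (fun x => g x ^+ 2)).
- by move=> k; apply/measurable_EFinP; exact: measurable_funX.
- exact: measurable_cst.
- apply: aeW => x Dx /=; apply/fine_cvgP; split; first exact: nearW.
  rewrite -(mulr0 0); apply: cvgM; exact: f0.
- exact: gi.
- apply: aeW => x k Dx /=; rewrite lee_fin normrX.
  rewrite -[leRHS]real_normK ?num_real// ler_sqr ?nnegrE//.
  exact: fg.
rewrite integral0 => /fine_cvgP[_]; apply: cvg_trans.
exact: cvg_refl.
Qed.

(** The truncated functions are dominated by [f] and vanish at [x] as soon as [N] exceeds the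
    absolute value of [f x], so dominated convergence applies. *)
Lemma nsq_tail f (e : R) : 0 < e -> L2 f -> exists N : nat,
  let t := fun x => if `|f x| <= N%:R then 0 else f x in L2 t /\ nsq t < e.
Proof.
move=> e0 Lf; have [mf fi] := Lf.
pose t (N : nat) x := if `|f x| <= N%:R then 0 else f x.
have mt N : measurable_fun D (t N).
  apply: measurable_fun_if => //.
    by apply: measurable_fun_ler => //; exact: measurableT_comp.
  by apply: measurable_funS mf.
have [||Lt] := @nsq_dominated t f mt Lf.
- move=> x Dx; apply: cvg_near_cst; near=> N; rewrite /t.
  suff -> : `|f x| <= N%:R by [].
  by near: N; exact: nbhs_infty_ger.
- by move=> k x _; rewrite /t; case: ifP => // _; rewrite normr0.
move=> /cvgr0Pnorm_lt/(_ e e0)[N _ /(_ N (leqnn N)) /=].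
by rewrite ger0_norm ?nsq_ge0// => tN; exists N => /=; split; [exact: (Lt N)|exact: tN].
Unshelve. all: by end_near. Qed.

Lemma nsq_eq0 f : L2 f -> nsq f <= 0 -> \forall x \ae mu, D x -> f x = 0.
Proof.
move=> [mf fi] f0.
have f0' : nsq f = 0 by apply/eqP; rewrite eq_le f0 nsq_ge0.
have mf2 : measurable_fun D (EFin \o (fun x => f x ^+ 2)).
  by apply/measurable_EFinP; exact: measurable_funX.
have : (\int[mu]_(x in D) `|(EFin \o (fun x => f x ^+ 2)%R) x| = 0)%E.
  under eq_integral do rewrite /= ger0_norm ?sqr_ge0//.
  apply: etrans (congr1 EFin f0'); rewrite /nsq /Rintegral fineK//.
  exact: integrable_fin_num.
move=> /(ae_eq_integral_abs mu mD mf2); apply: filterS => x fx /fx /= /eqP.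
by rewrite eqe sqrf_eq0 => /eqP.
Qed.

Lemma L2P f : f \_ D \in Lfun mu 2%:E <-> L2 f.
Proof.
split=> [Lf|[mf fi]].
  have := Lfun2_integrable_sqr Lf.
  have mf : measurable_fun D f.
    apply/(measurable_restrictT _ mD).
    by move: Lf; rewrite inE => /andP[+ _]; rewrite inE.
  rewrite (_ : EFin \o _ = (EFin \o (fun x => f x ^+ 2)) \_ D); last first.
    apply/funext => x /=; rewrite !patchE; case: ifP => //=.
    by rewrite expr0n.
  by move=> /(integrable_mkcond _ mD).2.
rewrite inE; apply/andP; split; rewrite inE/=.
  exact/(measurable_restrictT _ mD).
rewrite /finite_norm (@lty_poweRy _ _ 2)// poweR_Lnorm//.
move: fi => /(integrable_mkcond _ mD).1/integrableP[_]; apply: le_lt_trans.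
rewrite le_eqVlt; apply/orP; left; apply/eqP; apply: eq_integral => x _ /=.
rewrite !patchE; case: ifP => _ /=.
  by rewrite powR_mulrn// real_normK ?num_real// normrX real_normK ?num_real.
by rewrite !normr0 powR0.
Qed.

Lemma Lnorm2_sqr f : ('N[mu]_2%:E[EFin \o (f \_ D)] ^+ 2 =
  \int[mu]_(x in D) (f x ^+ 2)%:E)%E.
Proof.
rewrite -poweR_sqr ?Lnorm_ge0// poweR_Lnorm// [RHS]integral_mkcond.
apply: eq_integral => x _ /=; rewrite !patchE; case: ifP => _ /=.
  by rewrite powR_mulrn// real_normK ?num_real.
by rewrite normr0 powR0.
Qed.

End square_integrable.

(** * Smooth approximation of the positive part *)

Section smooth_positive_part.
Context {R : realType}.
Implicit Types (s t k : R).

Definition logistic t : R := 1 - (1 + expR t)^-1.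

(** Subtracting [ln 2] gives the value [0] at [0], so composition with [softplus k] keeps compact
    supports. *)
Definition softplus k t : R := k^-1 * (ln (1 + expR (k * t)) - ln 2).

(* The value at [0] is the limit of [logistic (k * 0)]; with it, no argument is
   needed to show that [grad u] vanishes almost everywhere on [u = 0]. *)
Definition heaviside t : R := if 0 < t then 1 else if t == 0 then 2^-1 else 0.

Lemma oneDexpR_gt0 t : 0 < 1 + expR t.
Proof. by rewrite addr_gt0// expR_gt0. Qed.

Lemma logistic_itv t : 0 <= logistic t <= 1.
Proof.
have e0 := oneDexpR_gt0 t; rewrite /logistic subr_ge0 invf_le1// lerDl expR_ge0/=.
by rewrite gerBl invr_ge0 ltW.
Qed.

Lemma is_derive_oneDexpR t : is_derive t 1 (fun x => 1 + expR x) (expR t).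
Proof.
have H : is_derive t 1 (cst 1 + expR) (0 + expR t) by exact: is_deriveD.
by rewrite add0r in H.
Qed.

Lemma is_derive_logistic t :
  is_derive t 1 logistic (logistic t * (1 - logistic t)).
Proof.
have e0 := oneDexpR_gt0 t; have e1 : 1 + expR t != 0 by rewrite gt_eqF.
have H1 := is_derive_oneDexpR t.
have [d1 E1] := H1.
have H2 : is_derive t 1 (fun x => (1 + expR x)^-1) (- (1 + expR t) ^- 2 * expR t).
  by split; [exact: derivableV|rewrite deriveV// E1].
have H3 := is_deriveB (is_derive_cst (1 : R) t 1) H2.
apply: (is_derive_eq H3).
rewrite /logistic.
by field.
Qed.

Lemma is_derive_scale k t : is_derive t 1 (fun x => k * x) k.
Proof.
have H := is_deriveZ k (is_derive_id t 1).
by apply: (is_derive_eq H); rewrite /GRing.scale /= mulr1.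
Qed.

Lemma is_derive_softplus k t : 0 < k ->
  is_derive t 1 (softplus k) (logistic (k * t)).
Proof.
move=> k0; have e0 := oneDexpR_gt0 (k * t).
have e1 : 1 + expR (k * t) != 0 by rewrite gt_eqF.
have H1 := is_derive_comp1 (is_derive_scale k t) (is_derive_oneDexpR (k * t)).
have H2 := is_derive_comp1 H1 (is_derive1_ln e0).
have H3 := is_deriveZ k^-1 (is_deriveB H2 (is_derive_cst (ln 2) t 1)).
apply: (is_derive_eq H3).
rewrite /logistic /GRing.scale /= subr0.
have k1 : k != 0 by rewrite gt_eqF.
by field; rewrite e1.
Qed.

(** As the logistic function [s] satisfies [s' = s (1 - s)], every derivative of positive order is a
    polynomial in [logistic (k * x)]. *)
Lemma softplus_smooth k l t : 0 < k -> derivable (derive1n l (softplus k)) t 1.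
Proof.
move=> k0; case: l => [|l]; first by case: (is_derive_softplus t k0).
suff [P ->] : exists P : {poly R},
    derive1n l.+1 (softplus k) = fun x => P.[logistic (k * x)].
  have H := is_derive_comp1 (is_derive_comp1 (is_derive_scale k t)
    (is_derive_logistic (k * t))) (is_derive_poly P (logistic (k * t))).
  by case: H.
elim: l => [|l [P IH]].
  exists 'X; rewrite derive1n1; apply/funext => x; rewrite hornerX derive1E.
  by case: (is_derive_softplus x k0).
exists (k%:P * P^`() * ('X * (1%:P - 'X))).
rewrite derive1nS IH; apply/funext => x.
have [_ H] := is_derive_comp1 (is_derive_comp1 (is_derive_scale k x)
    (is_derive_logistic (k * x))) (is_derive_poly P (logistic (k * x))).
rewrite derive1E [LHS]H !(hornerM, hornerD, hornerN, hornerX, hornerC); ring.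
Qed.

Lemma lipschitz_of_derive (f df : R -> R) (C : R) :
  (forall x : R, is_derive x 1 f (df x)) -> (forall x, `|df x| <= C) ->
  forall s t, `|f s - f t| <= C * `|s - t|.
Proof.
move=> fdf dfC.
have H s t : t <= s -> `|f s - f t| <= C * `|s - t|.
  move=> ts; have [|c _ ->] := @MVT_segment R f df t s ts (fun x _ => fdf x).
    apply: continuous_subspaceT => x; apply: differentiable_continuous.
    by apply/derivable1_diffP; case: (fdf x).
  by rewrite normrM ler_wpM2r.
move=> s t; case: (leP t s) => [/H//|/ltW/H].
by rewrite distrC (distrC t s).
Qed.

Lemma softplus_lipschitz k s t : 0 < k ->
  `|softplus k s - softplus k t| <= `|s - t|.
Proof.
move=> k0; rewrite -[leRHS]mul1r.
apply: (lipschitz_of_derive (df := fun x => logistic (k * x))) => x.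
  exact: is_derive_softplus.
by have /andP[? ?] := logistic_itv (k * x); rewrite ger0_norm.
Qed.

Lemma logistic_lipschitz k s t : 0 < k ->
  `|logistic (k * s) - logistic (k * t)| <= k * `|s - t|.
Proof.
move=> k0.
have -> : k * `|s - t| = 1 * `|k * s - k * t|.
  by rewrite -mulrBr normrM mul1r (gtr0_norm k0).
apply: (lipschitz_of_derive is_derive_logistic) => x.
have /andP[a b] := logistic_itv x.
have L0 : 0 <= logistic x * (1 - logistic x).
  by apply: mulr_ge0 => //; rewrite subr_ge0.
by rewrite ger0_norm//; nra.
Qed.

Lemma softplus0 k : softplus k 0 = 0.
Proof. by rewrite /softplus mulr0 expR0 (_ : 1 + 1 = 2)// subrr mulr0. Qed.

Lemma cvg0_le_harmonic (f : nat -> R) (C : R) :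
  (forall k : nat, `|f k| <= C * k.+1%:R^-1) -> f k @[k --> \oo] --> 0.
Proof.
move=> fC; apply/cvgr0Pnorm_le => e e0.
have C0 : 0 <= C.
  by have := le_trans (normr_ge0 _) (fC 0%N); rewrite invr1 mulr1.
have d0 : 0 < e / (C + 1) by rewrite divr_gt0// ltr_wpDl.
near=> k; rewrite (le_trans (fC k))//.
have : k.+1%:R^-1 < e / (C + 1) by near: k; exact: (near_infty_natSinv_lt (PosNum d0)).
rewrite ltr_pdivlMr ?ltr_wpDl// => /ltW; apply: le_trans.
by rewrite mulrC ler_wpM2l// lerDl.
Unshelve. all: by end_near. Qed.

Lemma softplus_cvg t : softplus k.+1%:R t @[k --> \oo] --> Num.max t 0.
Proof.
apply/subr_cvg0/(@cvg0_le_harmonic _ (ln 2)) => k; set K := k.+1%:R.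
have K0 : 0 < K :> R by rewrite ltr0n.
have ln20 : 0 <= ln 2 :> R by rewrite ln_ge0// ler1n.
have Hln x : x <= 0 -> 0 <= ln (1 + expR x) <= ln 2.
  move=> x0; rewrite ln_ge0 ?lerDl ?expR_ge0//= ler_ln ?posrE// ?oneDexpR_gt0//.
  by have : expR x <= 1; [rewrite expR_le1|lra].
(* For [t > 0] the factor [expR (K * t)] is taken out of the logarithm and accounts for [t]; what
   remains depends on the absolute value of [t] only. *)
have E : softplus K t - Num.max t 0 = K^-1 * (ln (1 + expR (- (K * `|t|))) - ln 2).
  rewrite /softplus; case: (leP t 0) => t0; last first.
    rewrite gtr0_norm//.
    have -> : 1 + expR (K * t) = expR (K * t) * (1 + expR (- (K * t))).
      by rewrite mulrDr mulr1 -expRD subrr expR0 addrC.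
    rewrite lnM ?posrE ?expR_gt0// ?oneDexpR_gt0// expRK.
    have K1 : K != 0 by rewrite gt_eqF.
    by field.
  by rewrite ler0_norm// mulrN opprK subr0.
have /Hln/andP[a b] : - (K * `|t|) <= 0 by rewrite oppr_le0 mulr_ge0// ltW.
have Ki : 0 < K^-1 by rewrite invr_gt0.
rewrite E normrM (gtr0_norm Ki) mulrC; apply: ler_wpM2r; first exact: ltW.
by rewrite ler_norml; apply/andP; split; lra.
Qed.

(** Away from [0] the bound [1 + x <= expR x] gives an error of at most [1 / (|t| (k + 1))]; at [0]
    the sequence is constantly [1 / 2]. *)
Lemma logistic_cvg t : logistic (k.+1%:R * t) @[k --> \oo] --> heaviside t.
Proof.
rewrite /heaviside; have [t0|t0|->] := ltgtP t 0; last first.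
- by apply: cvg_near_cst; apply: nearW => k; rewrite mulr0 /logistic expR0; field.
- rewrite -[X in _ --> X]subr0; apply: cvgB; first exact: cvg_cst.
  apply: (@cvg0_le_harmonic _ t^-1) => k; rewrite normfV gtr0_norm ?oneDexpR_gt0//.
  rewrite -invfM lef_pV2 ?posrE ?oneDexpR_gt0 ?mulr_gt0//.
  have := expR_ge1Dx (k.+1%:R * t); rewrite mulrC; lra.
- apply: (@cvg0_le_harmonic _ (- t)^-1) => k.
  have e0 := expR_gt0 (k.+1%:R * t).
  have -> : logistic (k.+1%:R * t) =
      (1 + expR (- (k.+1%:R * t)))^-1.
    rewrite expRN /logistic; field.
    by rewrite !gt_eqF ?oneDexpR_gt0// addrC oneDexpR_gt0.
  rewrite normfV gtr0_norm ?oneDexpR_gt0//.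
  rewrite -invfM lef_pV2 ?posrE ?oneDexpR_gt0 ?mulr_gt0 ?oppr_gt0//.
  have := expR_ge1Dx (- (k.+1%:R * t)); rewrite -mulrN mulrC; lra.
Qed.

End smooth_positive_part.

(** * The space H^1_0 as the closure of the test functions *)

Section test_integrals.
Context {R : realType} {n : nat} (Omega : set 'rV[R]_n).
Local Notation leb := (@lebesgue_rV R n).
Hypothesis oO : open Omega.
Implicit Types (phi psi eta : 'rV[R]_n -> R).

Let mO : measurable Omega. Proof. exact: open_measurable_rV. Qed.

Lemma test_bounded_support phi : test_function Omega phi -> exists M : R,
  forall x, M < `|x| -> phi x = 0 /\ forall i, partial i phi x = 0.
Proof.
move=> /test_partial0[K [cK _] K0].
have [M [_ MK]] := compact_bounded cK.
exists (M + 1) => x Mx; apply: K0 => Kx.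
have := MK (M + 1); rewrite ltrDl ltr01 => /(_ isT x Kx) /=.
by rewrite leNgt Mx.
Qed.

Lemma test_L2 phi : test_function Omega phi -> L2 leb Omega phi.
Proof.
move=> tphi; have cphi := test_continuous tphi; split.
  by apply: measurable_funTS; exact: continuous_measurable_rV.
have [M M0] := test_bounded_support tphi.
apply: (integrableS measurableT mO) => //.
apply: (@compact_support_integrable _ _ _ M) => [x|x /M0[-> _]].
  exact: (continuousM (cphi x) (cphi x)).
by rewrite expr0n.
Qed.

Lemma test_partial_L2 phi i : test_function Omega phi -> L2 leb Omega (partial i phi).
Proof.
move=> tphi; have cphi := @test_partial_continuous _ _ _ phi i tphi; split.
  by apply: measurable_funTS; exact: continuous_measurable_rV.
have [M M0] := test_bounded_support tphi.
apply: (integrableS measurableT mO) => //.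
apply: (@compact_support_integrable _ _ _ M) => [x|x /M0[_ ->]].
  exact: (continuousM (cphi x) (cphi x)).
by rewrite expr0n.
Qed.

Lemma integral_test_partial eta i : test_function Omega eta ->
  \int[leb]_(x in Omega) partial i eta x = 0.
Proof.
move=> teta; have [M M0] := test_bounded_support teta.
rewrite Rintegral_mkcond (_ : _ \_ _ = partial i eta); last first.
  apply/funext => x; rewrite patchE; case: ifPn => // /negP xO.
  have [K [_ KO] K0] := test_partial0 teta.
  rewrite (K0 x _).2// => /KO Ox; apply: xO; exact: mem_set.
rewrite /Rintegral (@integral_partial0 _ _ eta i M)//.
- exact: test_continuous teta.
- by move=> x; exact: test_derivable teta.
- exact: test_partial_continuous teta.
- by move=> x /M0[].
- by move=> x /M0[].
Qed.

Lemma test_by_parts phi psi i : test_function Omega phi ->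
  test_function Omega psi ->
  \int[leb]_(x in Omega) (phi x * partial i psi x) =
  - \int[leb]_(x in Omega) (partial i phi x * psi x).
Proof.
move=> tphi tpsi; apply/eqP; rewrite -subr_eq0 opprK; apply/eqP.
have i1 := L2_mul_integrable mO (test_L2 tphi) (test_partial_L2 i tpsi).
have i2 := L2_mul_integrable mO (test_partial_L2 i tphi) (test_L2 tpsi).
rewrite -RintegralD//.
have tM : test_function Omega (phi \* psi) by apply: test_functionM => //; case: tpsi.
rewrite -(integral_test_partial i tM); apply: eq_Rintegral => x _.
rewrite partialM; [|exact: test_derivable tphi|exact: test_derivable tpsi].
by rewrite [psi x * _]mulrC.
Qed.

(* Integrate [d_i (x_i phi^2) = phi^2 + 2 x_i phi d_i phi]. *)
Lemma test_poincare (M : R) (i : 'I_n) phi :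
  (forall x, Omega x -> `|x 0 i| <= M) -> test_function Omega phi ->
  nsq leb Omega phi <= 4 * M ^+ 2 * nsq leb Omega (partial i phi).
Proof.
move=> OM tphi; have [mphi iphi] := test_L2 tphi.
have [mpphi ipphi] := test_partial_L2 i tphi.
have Cphi k : Ck k phi by case: tphi.
pose eta := phi \* (phi \* (fun x : 'rV[R]_n => x 0 i)).
have teta : test_function Omega eta.
  by apply: test_functionM => // k; apply: CkM => //; exact: Ck_coord.
have etaE x : partial i eta x = phi x ^+ 2 + 2 * x 0 i * phi x * partial i phi x.
  have dphi := derivableP (@test_derivable _ _ _ _ i x tphi).
  have [_ E] := is_deriveM dphi (is_deriveM dphi (is_derive_coord i x 'e_i)).
  have -> : partial i eta x = phi x * (phi x * ('e_i : 'rV[R]_n) 0 i +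
    x 0 i * partial i phi x) + (phi x * x 0 i) * partial i phi x := E.
  rewrite mxE !eqxx /=; ring.
have i1 : leb.-integrable Omega (EFin \o (fun x => 2^-1 * phi x ^+ 2)).
  by have := integrableZl mO 2^-1 iphi; apply: eq_integrable.
have i2 : leb.-integrable Omega
    (EFin \o (fun x => 2 * M ^+ 2 * partial i phi x ^+ 2)).
  by have := integrableZl mO (2 * M ^+ 2) ipphi; apply: eq_integrable.
have ie : leb.-integrable Omega (EFin \o partial i eta).
  have := L2_mul_integrable mO (test_L2 tphi) (test_L2 tphi).
  have Lxp : L2 leb Omega ((fun x : 'rV[R]_n => x 0 i) \* phi).
    apply: L2_mulb (test_L2 tphi) OM => //.
    exact: (measurable_funTS (measurable_rV_coord i)).
  have ixpp := L2_mul_integrable mO Lxp (test_partial_L2 i tphi).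
  move=> /(integrableD mO)/(_ (integrableZl mO 2 ixpp)).
  by apply: eq_integrable => // x _ /=; rewrite etaE -EFinM -EFinD; congr EFin; ring.
have : \int[leb]_(x in Omega) (2^-1 * phi x ^+ 2 - 2 * M ^+ 2 * partial i phi x ^+ 2) <=
    \int[leb]_(x in Omega) partial i eta x.
  apply: le_Rintegral => //; first exact: (integrableB mO i1 i2).
  move=> x Ox; rewrite etaE; have := OM x Ox.
  rewrite ler_norml => /andP[xM Mx].
  have xx : x 0 i ^+ 2 <= M ^+ 2 by nra.
  (* Half of this square gives [2 x_i phi d_i phi >= - phi^2 / 2 - 2 x_i^2 (d_i phi)^2]. *)
  have H1 := sqr_ge0 (phi x + 2 * x 0 i * partial i phi x).
  have H2 := sqr_ge0 (partial i phi x).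
  nra.
rewrite integral_test_partial// RintegralB// !RintegralZl//.
rewrite -/(nsq leb Omega phi) -/(nsq leb Omega (partial i phi)).
move: (nsq _ _ _) (nsq _ _ _) => A B H; lra.
Qed.

End test_integrals.

(** * Closure properties, weak gradients and Poincare's inequality in [H10] *)

Section H10_theory.
Context {R : realType} {n : nat} (Omega : set 'rV[R]_n).
Local Notation leb := (@lebesgue_rV R n).
Local Notation L2 := (L2 leb Omega).
Local Notation nsq := (nsq leb Omega).
Hypothesis oO : open Omega.
Implicit Types (phi psi eta u v : 'rV[R]_n -> R) (Du Dv : 'I_n -> 'rV[R]_n -> R).

Let mO : measurable Omega. Proof. exact: open_measurable_rV. Qed.

Lemma L2norm_lt u (e : R) : measurable_fun Omega u ->
  (L2norm Omega u ^+ 2 < e%:E)%E <-> L2 u /\ nsq u < e.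
Proof.
move=> mu; rewrite /L2norm Lnorm2_sqr//.
have mu2 : measurable_fun Omega (EFin \o (fun x => u x ^+ 2)).
  by apply/measurable_EFinP; exact: measurable_funX.
have E : (\int[leb]_(x in Omega) (u x ^+ 2)%:E =
    \int[leb]_(x in Omega) `|(EFin \o (fun x => u x ^+ 2)%R) x|)%E.
  by apply: eq_integral => x _ /=; rewrite ger0_norm// sqr_ge0.
split=> [ue|[[_ iu] ue]].
  have iu : leb.-integrable Omega (EFin \o (fun x => u x ^+ 2)).
    by apply/integrableP; split => //; rewrite -E (lt_le_trans ue)// leey.
  split => //; rewrite -lte_fin /nsq /Rintegral fineK//.
  exact: integrable_fin_num.
by move: ue; rewrite -lte_fin /nsq /Rintegral fineK//; exact: integrable_fin_num.
Qed.


Definition L2pair u Du := L2 u /\ forall i, L2 (Du i).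

Lemma H1sqnorm_ge0 u Du : (0 <= H1sqnorm Omega u Du)%E.
Proof.
rewrite /H1sqnorm /L2norm Lnorm2_sqr// adde_ge0//.
  by apply: integral_ge0 => x _; rewrite lee_fin sqr_ge0.
apply: sume_ge0 => i _; rewrite Lnorm2_sqr//.
by apply: integral_ge0 => x _; rewrite lee_fin sqr_ge0.
Qed.

Lemma L2norm_sqr_ge0 u : (0 <= L2norm Omega u ^+ 2)%E.
Proof.
rewrite /L2norm Lnorm2_sqr//.
by apply: integral_ge0 => x _; rewrite lee_fin sqr_ge0.
Qed.

Lemma L2norm_nsq u : L2 u -> (L2norm Omega u ^+ 2 = (nsq u)%:E)%E.
Proof.
move=> [mu iu]; rewrite /L2norm Lnorm2_sqr// /nsq /Rintegral fineK//.
exact: integrable_fin_num.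
Qed.

Lemma H1sqnormE u Du : L2pair u Du ->
  H1sqnorm Omega u Du = (nsq u + \sum_(i < n) nsq (Du i))%:E.
Proof.
move=> [Lu LDu]; rewrite /H1sqnorm L2norm_nsq// EFinD; congr (_ + _)%E.
by rewrite -sumEFin; apply: eq_bigr => i _; exact: L2norm_nsq.
Qed.

(** Membership in the closure in epsilon form, with the components of the distance bounded one by
    one; [H10_near_test] and [near_test_H10] pass between it and [H10]. *)
Definition near_test (e : R) u Du phi := [/\ test_function Omega phi,
  L2 (u \- phi) /\ nsq (u \- phi) < e &
  forall i, L2 (Du i \- partial i phi) /\ nsq (Du i \- partial i phi) < e].

Lemma measurable_test phi : test_function Omega phi -> measurable_fun Omega phi.
Proof. by move=> /(test_L2 oO)[]. Qed.

Lemma measurable_test_partial phi i : test_function Omega phi ->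
  measurable_fun Omega (partial i phi).
Proof. by move=> /(test_partial_L2 oO i)[]. Qed.

Lemma H10_near_test u Du : measurable_fun Omega u ->
  (forall i, measurable_fun Omega (Du i)) -> H10 Omega u Du ->
  forall e : R, 0 < e -> exists phi, near_test e u Du phi.
Proof.
move=> mu mDu [phi [tphi cphi]] e e0.
have : \forall k \near \oo, (H1sqnorm Omega (u \- phi k)%R
    (fun i => Du i \- partial i (phi k))%R < e%:E)%E.
  apply: (cphi [set y | (y < e%:E)%E]); apply: open_nbhs_nbhs; split.
    exact: open_ereal_lt_ereal.
  by rewrite /= lte_fin.
move=> [N _ /(_ N (leqnn N)) /= He]; exists (phi N); split => //.
  apply/L2norm_lt; first exact: measurable_funB mu (measurable_test (tphi N)).
  apply: le_lt_trans He; rewrite /H1sqnorm leeDl//.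
  by apply: sume_ge0 => i _; exact: L2norm_sqr_ge0.
move=> i; apply/L2norm_lt.
  exact: measurable_funB (mDu i) (measurable_test_partial i (tphi N)).
apply: le_lt_trans He; rewrite /H1sqnorm (bigD1 i)//= addeCA leeDl//.
rewrite adde_ge0 ?L2norm_sqr_ge0//.
by apply: sume_ge0 => j _; exact: L2norm_sqr_ge0.
Qed.

Lemma near_test_H10 u Du :
  (forall e : R, 0 < e -> exists phi, near_test e u Du phi) -> H10 Omega u Du.
Proof.
move=> H; have h0 (k : nat) : 0 < k.+1%:R^-1 :> R by rewrite invr_gt0.
have /choice[phi Hphi] : forall k : nat, exists phi, near_test k.+1%:R^-1 u Du phi.
  by move=> k; exact: H.
exists phi; split; first by move=> k; case: (Hphi k).
rewrite (_ : (fun k => _) = (fun k => (nsq (u \- phi k) +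
    \sum_(i < n) nsq (Du i \- partial i (phi k)))%:E)); last first.
  apply/funext => k; have [tk [Lk _] Lik] := Hphi k; rewrite H1sqnormE//.
  by split => // i; case: (Lik i).
apply/fine_cvgP; split; first exact: nearW.
(* The distance has [n.+1] components: the function and its [n] derivatives. *)
apply: (@cvg0_le_harmonic _ _ n.+1%:R) => k /=.
have [tk [Lk lk] Lik] := Hphi k.
rewrite ger0_norm; last by rewrite addr_ge0 ?nsq_ge0// sumr_ge0// => i _; exact: nsq_ge0.
have -> : n.+1%:R * k.+1%:R^-1 = k.+1%:R^-1 + n%:R * k.+1%:R^-1 :> R.
  by rewrite -natr1; ring.
apply: lerD; first exact: ltW.
apply: (@le_trans _ _ (\sum_(i < n) k.+1%:R^-1)).
  by apply: ler_sum => i _; apply: ltW; case: (Lik i).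
by rewrite sumr_const card_ord mulr_natl.
Qed.

(** Adds two approximation errors; the factors 2 are those of [nsqD] and [nsqB]. *)
Lemma lt_quarter (a b c e : R) : c <= 2 * a + 2 * b -> a < e / 4 -> b < e / 4 ->
  c < e.
Proof. by move=> ? ? ?; lra. Qed.

Lemma H10_closed u Du : measurable_fun Omega u ->
  (forall i, measurable_fun Omega (Du i)) ->
  (forall e : R, 0 < e -> exists v Dv, [/\ H10 Omega v Dv, L2pair v Dv,
     L2 (u \- v) /\ nsq (u \- v) < e &
     forall i, L2 (Du i \- Dv i) /\ nsq (Du i \- Dv i) < e]) ->
  H10 Omega u Du.
Proof.
move=> mu mDu H; apply: near_test_H10 => e e0.
have e4 : 0 < e / 4 by rewrite divr_gt0.
have [v [Dv [Hv [Lv LDv] [Luv uv] LDuv]]] := H _ e4.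
have mLv : measurable_fun Omega v by case: Lv.
have mLDv i : measurable_fun Omega (Dv i) by case: (LDv i).
have [phi [tphi [Lvp vp] LDvp]] := H10_near_test mLv mLDv Hv e4.
exists phi; split => //.
  have := nsqD mO Luv Lvp.
  rewrite (_ : (u \- v) \+ (v \- phi) = u \- phi).
    by move=> [LL ll]; split; [exact: LL|exact: (lt_quarter ll uv vp)].
  by apply/funext => x /=; ring.
move=> i; have [Li li] := LDuv i; have [Li' li'] := LDvp i.
have := nsqD mO Li Li'.
rewrite (_ : (Du i \- Dv i) \+ (Dv i \- partial i phi) = Du i \- partial i phi).
  by move=> [LL ll]; split; [exact: LL|exact: (lt_quarter ll li li')].
by apply/funext => x /=; ring.
Qed.

Lemma H10B u Du v Dv : measurable_fun Omega u ->
  (forall i, measurable_fun Omega (Du i)) -> measurable_fun Omega v ->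
  (forall i, measurable_fun Omega (Dv i)) ->
  H10 Omega u Du -> H10 Omega v Dv ->
  H10 Omega (u \- v) (fun i => Du i \- Dv i).
Proof.
move=> mu mDu mv mDv Hu Hv; apply: near_test_H10 => e e0.
have e4 : 0 < e / 4 by rewrite divr_gt0.
have [phi [tphi [Lu lu] LDu]] := H10_near_test mu mDu Hu e4.
have [psi [tpsi [Lv lv] LDv]] := H10_near_test mv mDv Hv e4.
exists (phi \- psi); split; first exact: test_functionB.
  have := nsqB mO Lu Lv.
  rewrite (_ : (u \- phi) \- (v \- psi) = (u \- v) \- (phi \- psi)).
    by move=> [LL ll]; split; [exact: LL|exact: (lt_quarter ll lu lv)].
  by apply/funext => x /=; ring.
move=> i; have [Li li] := LDu i; have [Li' li'] := LDv i.
have := nsqB mO Li Li'; rewrite (partial_testB i tphi tpsi).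
rewrite (_ : (Du i \- partial i phi) \- (Dv i \- partial i psi) =
   (Du i \- Dv i) \- (partial i phi \- partial i psi)).
  by move=> [LL ll]; split; [exact: LL|exact: (lt_quarter ll li li')].
by apply/funext => x /=; ring.
Qed.

(** Integration by parts holds for the approximating test functions and passes to the limit by
    [L2_mul_le]. This supplies the proof field needed to turn a pair in [H10] into an element of
    [H1]. *)
Lemma H10_weak_gradient u Du i phi : L2pair u Du -> H10 Omega u Du ->
  test_function Omega phi ->
  \int[leb]_(x in Omega) (u x * partial i phi x) =
  - \int[leb]_(x in Omega) (Du i x * phi x).
Proof.
move=> [Lu LDu] Hu tphi.
have Lphi := test_L2 oO tphi; have Lpphi := test_partial_L2 oO i tphi.
apply/eqP; rewrite -subr_eq0 opprK -normr_eq0 eq_le normr_ge0 andbT.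
apply/ler_addgt0Pr => e e0; rewrite add0r.
(* [dl] is the parameter in Young's inequality. With [dl * C = e / 4] and approximation errors below
   [e / 4 * dl], each of the three contributions is at most [e / 4]. *)
pose C := nsq phi + nsq (partial i phi) + 1.
have C0 : 0 < C by rewrite ltr_wpDl// addr_ge0 ?nsq_ge0.
pose dl := e / (4 * C).
have dl0 : 0 < dl by rewrite divr_gt0// mulr_gt0.
have ed0 : 0 < e / 4 * dl by rewrite mulr_gt0// divr_gt0.
have mu : measurable_fun Omega u by case: Lu.
have mDu j : measurable_fun Omega (Du j) by case: (LDu j).
have [psi [tpsi [L1 l1] L2_]] := H10_near_test mu mDu Hu ed0.
have [L2' l2'] := L2_ i.
have B1 := L2_mul_le mO dl0 L1 Lpphi.
have B2 := L2_mul_le mO dl0 L2' Lphi.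
have E1 : \int[leb]_(x in Omega) ((u \- psi) x * partial i phi x) =
    \int[leb]_(x in Omega) (u x * partial i phi x) -
    \int[leb]_(x in Omega) (psi x * partial i phi x).
  rewrite -RintegralB//; first by apply: eq_Rintegral => x _ /=; ring.
    exact: (L2_mul_integrable mO Lu Lpphi).
  exact: (L2_mul_integrable mO (test_L2 oO tpsi) Lpphi).
have E2 : \int[leb]_(x in Omega) ((Du i \- partial i psi) x * phi x) =
    \int[leb]_(x in Omega) (Du i x * phi x) -
    \int[leb]_(x in Omega) (partial i psi x * phi x).
  rewrite -RintegralB//; first by apply: eq_Rintegral => x _ /=; ring.
    exact: (L2_mul_integrable mO (LDu i) Lphi).
  exact: (L2_mul_integrable mO (test_partial_L2 oO i tpsi) Lphi).
have E3 := test_by_parts oO i tpsi tphi.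
have -> : \int[leb]_(x in Omega) (u x * partial i phi x) +
    \int[leb]_(x in Omega) (Du i x * phi x) =
    \int[leb]_(x in Omega) ((u \- psi) x * partial i phi x) +
    \int[leb]_(x in Omega) ((Du i \- partial i psi) x * phi x).
  by rewrite E1 E2 E3; ring.
apply: (le_trans (ler_normD _ _)); apply: (le_trans (lerD B1 B2)).
have b1 : nsq (u \- psi) / dl <= e / 4 by rewrite ler_pdivrMr// ltW.
have b2 : nsq (Du i \- partial i psi) / dl <= e / 4 by rewrite ler_pdivrMr// ltW.
have b3 : dl * nsq phi + dl * nsq (partial i phi) <= e / 4.
  have -> : e / 4 = dl * C by rewrite /dl; field; rewrite gt_eqF.
  by rewrite -mulrDr ler_wpM2l ?ltW// /C; lra.
lra.
Qed.

(** Approximation by test functions uses the bound [2 a + 2 b] twice, for the function and for its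
    derivative, which raises the constant 4 of [test_poincare] to 16. *)
Lemma H10_poincare (M : R) (i : 'I_n) u Du :
  (forall x, Omega x -> `|x 0 i| <= M) -> L2pair u Du -> H10 Omega u Du ->
  nsq u <= 16 * M ^+ 2 * nsq (Du i).
Proof.
move=> OM [Lu LDu] Hu; apply/ler_addgt0Pr => e e0.
have mu : measurable_fun Omega u by case: Lu.
have mDu j : measurable_fun Omega (Du j) by case: (LDu j).
pose C := 2 + 16 * M ^+ 2.
have C0 : 0 < C by rewrite ltr_wpDr// mulr_ge0// sqr_ge0.
have eC : 0 < e / C by rewrite divr_gt0.
have [phi [tphi [L1 l1] LD]] := H10_near_test mu mDu Hu eC.
have [L2' l2'] := LD i.
have P := test_poincare oO OM tphi.
have [_] := nsqD mO L1 (test_L2 oO tphi).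
rewrite (_ : (u \- phi) \+ phi = u); last by apply/funext => x /=; rewrite subrK.
have [_] := nsqB mO (LDu i) L2'.
rewrite (_ : Du i \- (Du i \- partial i phi) = partial i phi); last first.
  by apply/funext => x /=; rewrite subKr.
have M2 := sqr_ge0 M.
move=> A B.
have eE : e = 2 * (e / C) + 16 * M ^+ 2 * (e / C).
  by rewrite -mulrDl -/C mulrCA mulfV ?mulr1// gt_eqF.
have P' : nsq phi <= 4 * M ^+ 2 * (2 * nsq (Du i) + 2 * (e / C)).
  rewrite (le_trans P)//; apply: ler_wpM2l; first by rewrite mulr_ge0.
  by move: A l2'; move: (e / C) (nsq _) (nsq _) (nsq _) => t a b c; lra.
rewrite {}eE; move: (e / C) l1 P' B => t; move: (nsq _) (nsq _) (nsq _) => a b c.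
by move: (M ^+ 2) => m; lra.
Qed.

End H10_theory.

(** * Positive parts in H^1_0 *)

Section positive_part.
Context {R : realType} {n : nat} (Omega : set 'rV[R]_n).
Local Notation leb := (@lebesgue_rV R n).
Local Notation L2 := (L2 leb Omega).
Local Notation nsq := (nsq leb Omega).
Hypothesis oO : open Omega.
Implicit Types (phi psi eta u v : 'rV[R]_n -> R) (Du Dv : 'I_n -> 'rV[R]_n -> R).

Let mO : measurable Omega. Proof. exact: open_measurable_rV. Qed.

Lemma measurable_logistic (k : R) u : measurable_fun Omega u ->
  measurable_fun Omega (fun x => logistic (k * u x)).
Proof.
move=> mu; have cl : continuous (@logistic R).
  move=> t; apply: differentiable_continuous; apply/derivable1_diffP.
  by case: (is_derive_logistic t).
apply: (measurableT_comp (continuous_measurable_fun cl)).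
exact: measurable_funM.
Qed.

Lemma measurable_softplus (k : R) u : 0 < k -> measurable_fun Omega u ->
  measurable_fun Omega (softplus k \o u).
Proof.
move=> k0 mu; have cl : continuous (softplus k).
  move=> t; apply: differentiable_continuous; apply/derivable1_diffP.
  by case: (is_derive_softplus t k0).
exact: (measurableT_comp (continuous_measurable_fun cl)).
Qed.

Lemma logistic_norm_le1 (t : R) : `|logistic t| <= 1.
Proof. by have /andP[? ?] := logistic_itv t; rewrite ger0_norm. Qed.

Lemma softplus_norm_le (k t : R) : 0 < k -> `|softplus k t| <= `|t|.
Proof.
by move=> k0; have := softplus_lipschitz t 0 k0; rewrite softplus0 !subr0.
Qed.

Lemma L2pair_softplus (k : R) u Du : 0 < k -> L2pair Omega u Du ->
  L2pair Omega (softplus k \o u) (fun i x => logistic (k * u x) * Du i x).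
Proof.
move=> k0 [Lu LDu]; have mu : measurable_fun Omega u by case: Lu.
split.
  have [|//] := nsq_le mO (measurable_softplus k0 mu) Lu.
  by move=> x _; exact: softplus_norm_le.
move=> i; apply: (L2_mulb mO (measurable_logistic k mu) (LDu i)) => x _.
exact: logistic_norm_le1.
Qed.

(** Write [a d - b d' = b (d - d') + (a - b) d]. The factor [d] in the last product is unbounded: up
    to the level [N] the Lipschitz bound on the logistic function is used, and beyond it only
    [|a - b| <= 1], at the price of the tail of [d]. *)
Lemma near_test_softplus_term (k l l' d d' : R) (N : nat) : 0 < k ->
  (logistic (k * l) * d - logistic (k * l') * d') ^+ 2 <=
  2 * (d - d') ^+ 2 + 2 * (k * N%:R) ^+ 2 * (l - l') ^+ 2 +
  2 * (if `|d| <= N%:R then 0 else d) ^+ 2.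
Proof.
move=> k0; set a := logistic (k * l); set b := logistic (k * l').
have /andP[a0 a1] := logistic_itv (k * l); have /andP[b0 b1] := logistic_itv (k * l').
have ab := logistic_lipschitz l l' k0.
have S : (a * d - b * d') ^+ 2 <= 2 * (d - d') ^+ 2 + 2 * ((a - b) ^+ 2 * d ^+ 2).
  have -> : a * d - b * d' = b * (d - d') + (a - b) * d by ring.
  set p := d - d'; set q := (a - b) * d.
  have -> : (a - b) ^+ 2 * d ^+ 2 = q ^+ 2 by rewrite /q; ring.
  have H := sqr_ge0 (b * p - q).
  have b2 : (b * p) ^+ 2 <= p ^+ 2.
    by rewrite exprMn ler_piMl ?sqr_ge0// expr_le1.
  by move: H b2; move: (b * p) => r; nra.
apply: (le_trans S); rewrite -[leRHS]addrA lerD2l.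
case: ifPn => [dN|_].
  rewrite expr0n /= mulr0 addr0 -mulrA ler_wpM2l// exprMn.
  have A2 : (a - b) ^+ 2 <= k ^+ 2 * (l - l') ^+ 2.
    rewrite -exprMn -[leLHS]real_normK ?num_real// -[leRHS]real_normK ?num_real//.
    by rewrite ler_sqr ?nnegrE// normrM (gtr0_norm k0).
  have D2 : d ^+ 2 <= N%:R ^+ 2.
    by rewrite -[leLHS]real_normK ?num_real// ler_sqr ?nnegrE.
  have -> : k ^+ 2 * N%:R ^+ 2 * (l - l') ^+ 2 = (k ^+ 2 * (l - l') ^+ 2) * N%:R ^+ 2.
    by ring.
  by apply: ler_pM => //; exact: sqr_ge0.
rewrite -[leLHS]add0r; apply: lerD.
  by apply: mulr_ge0; [apply: mulr_ge0 => //|]; exact: sqr_ge0.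
rewrite ler_wpM2l// ler_piMl ?sqr_ge0//.
have -> : (a - b) ^+ 2 = `|a - b| ^+ 2 by rewrite real_normK ?num_real.
rewrite expr_le1// ler_norml; apply/andP; split; rewrite /a /b; lra.
Qed.

Lemma H10_softplus (k : R) u Du : 0 < k -> L2pair Omega u Du -> H10 Omega u Du ->
  H10 Omega (softplus k \o u) (fun i x => logistic (k * u x) * Du i x).
Proof.
move=> k0 /[dup] Lp [Lu LDu] Hu; apply: near_test_H10 => // e e0.
have [_ LDsp] := L2pair_softplus k0 Lp.
have mu : measurable_fun Omega u by case: Lu.
have mDu i : measurable_fun Omega (Du i) by case: (LDu i).
have e8 : 0 < e / 8 by rewrite divr_gt0.
have /choice[N tN] := fun i => nsq_tail mO e8 (LDu i).
(* A common bound of all levels [N i], so that a single test function serves all components. The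
   choice [C * dl = e / 2] leaves room for the tail, which costs less than [2 * (e / 8)]. *)
pose S : nat := \sum_i N i.
pose C := 2 + 2 * (k * S%:R) ^+ 2.
have C2 : 2 <= C by rewrite lerDl mulr_ge0 ?sqr_ge0.
have C0 : 0 < C by rewrite (lt_le_trans _ C2).
pose dl := e / (2 * C).
have dl0 : 0 < dl by rewrite divr_gt0// mulr_gt0.
have Cdl : C * dl = e / 2 by rewrite /dl; field; rewrite gt_eqF.
have [phi [tphi [L1 l1] LD]] := H10_near_test oO mu mDu Hu dl0.
have tG : test_function Omega (softplus k \o phi).
  by apply: test_function_comp => //; [move=> l x; exact: softplus_smooth|exact: softplus0].
have pG i : partial i (softplus k \o phi) =
    (fun x => logistic (k * phi x) * partial i phi x).
  rewrite (partial_comp i tphi); last by move=> x; case: (is_derive_softplus x k0).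
  apply/funext => x /=; congr (_ * _); rewrite derive1E.
  by case: (is_derive_softplus (phi x) k0).
exists (softplus k \o phi); split => //.
  have [||LL ll] := @nsq_le _ _ _ leb Omega mO
      ((softplus k \o u) \- (softplus k \o phi)) (u \- phi) _ L1.
  - apply: measurable_funB; first exact: measurable_softplus.
    exact: measurable_softplus (measurable_test oO tphi).
  - by move=> x _ /=; exact: softplus_lipschitz.
  split; first exact: LL.
  apply: (le_lt_trans ll); apply: (lt_le_trans l1).
  by move: Cdl dl0; clear -C2 e0; move: dl => t; nra.
move=> i; have [Lt lt_] := tN i; have [L2' l2'] := LD i.
rewrite pG.
have [//||//|||LL ll] := @nsq_le3 _ _ _ leb Omega mO
  ((fun x => logistic (k * u x) * Du i x) \- (fun x => logistic (k * phi x) * partial i phi x))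
  _ _ _ 2 (2 * (k * (N i)%:R) ^+ 2) 2 _ _ _ _ L2' L1 Lt.
- by rewrite mulr_ge0 ?sqr_ge0.
- apply: measurable_funB; first by case: (LDsp i).
  apply: measurable_funM; first exact: measurable_logistic (measurable_test oO tphi).
  exact: measurable_test_partial.
- by move=> x _ /=; exact: near_test_softplus_term.
split; first exact: LL.
apply: (le_lt_trans ll).
have NS : (k * (N i)%:R) ^+ 2 <= (k * S%:R) ^+ 2.
  rewrite !exprMn ler_wpM2l ?sqr_ge0// ler_sqr ?nnegrE// ler_nat.
  by rewrite /S (bigD1 i)//= leq_addr.
have ns0 := nsq_ge0 leb Omega (u \- phi).
move: l1 l2' lt_ Cdl NS ns0 dl0; clear - e0; rewrite /C.
move: (nsq _) (nsq _) (nsq _) => a b c.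
move: ((k * (N i)%:R) ^+ 2) ((k * S%:R) ^+ 2) (sqr_ge0 (k * S%:R)) => p q q0.
move: dl => t l1 l2 lt_ Cdl NS ns0 dl0; nra.
Qed.

Lemma heaviside_itv (t : R) : 0 <= heaviside t <= 1.
Proof. by rewrite /heaviside; case: ifP => _; [|case: ifP => _]; apply/andP; split; lra. Qed.

Lemma measurable_heaviside u : measurable_fun Omega u ->
  measurable_fun Omega (fun x => heaviside (u x)).
Proof.
move=> mu; have mh : measurable_fun setT (@heaviside R).
  apply: measurable_fun_ifT => //; first exact: measurable_fun_ltr.
  by apply: measurable_fun_ifT => //; exact: measurable_fun_eqr.
exact: (measurableT_comp mh mu).
Qed.

Lemma L2pair_pos u Du : L2pair Omega u Du ->
  L2pair Omega (fun x => Num.max (u x) 0) (fun i x => heaviside (u x) * Du i x).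
Proof.
move=> [Lu LDu]; have mu : measurable_fun Omega u by case: Lu.
split.
  have [||//] := @nsq_le _ _ _ leb Omega mO (fun x => Num.max (u x) 0) u _ Lu.
  - exact: measurable_maxr.
  - by move=> x _; case: (leP (u x) 0) => // _; rewrite normr0.
move=> i; apply: (L2_mulb mO (measurable_heaviside mu) (LDu i) (C := 1)) => x _.
by have /andP[? ?] := heaviside_itv (u x); rewrite ger0_norm.
Qed.

(** The pairs of [H10_softplus] converge to this one as [k] grows, by dominated convergence with
    bounds [2 |u|] and [|Du i|], and [H10] is closed. *)
Lemma H10_pos u Du : L2pair Omega u Du -> H10 Omega u Du ->
  H10 Omega (fun x => Num.max (u x) 0) (fun i x => heaviside (u x) * Du i x).
Proof.
move=> Lp Hu; have [Lu LDu] := Lp; have [Lpos LDpos] := L2pair_pos Lp.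
have k0 (k : nat) : 0 < k.+1%:R :> R by rewrite ltr0n.
pose f_ (k : nat) x := Num.max (u x) 0 - softplus k.+1%:R (u x).
pose g_ i (k : nat) x := heaviside (u x) * Du i x - logistic (k.+1%:R * u x) * Du i x.
have mf k : measurable_fun Omega (f_ k).
  apply: measurable_funB; first by case: Lpos.
  by case: (L2pair_softplus (k0 k) Lp) => -[].
have mg i k : measurable_fun Omega (g_ i k).
  apply: measurable_funB; first by case: (LDpos i).
  by case: (L2pair_softplus (k0 k) Lp) => _ /(_ i)[].
have [L2u _] := nsqD mO Lu Lu.
have [||Lf cf] := nsq_dominated mO mf L2u.
- move=> x _; rewrite -[X in _ --> X](subrr (Num.max (u x) 0)).
  by apply: cvgB; [exact: cvg_cst|exact: softplus_cvg].
- move=> k x _; rewrite /f_ /= -mulr2n normrMn mulr2n.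
  rewrite (le_trans (ler_normB _ _))// lerD ?softplus_norm_le//.
  by case: (leP (u x) 0) => // _; rewrite normr0.
have Hg i : (forall k, L2 (g_ i k)) /\ nsq (g_ i k) @[k --> \oo] --> 0.
  apply: (nsq_dominated mO (mg i) (LDu i)).
  - move=> x _; rewrite -[X in _ --> X](subrr (heaviside (u x) * Du i x)).
    apply: cvgB; first exact: cvg_cst.
    by apply: cvgMr_tmp; exact: logistic_cvg.
  - move=> k x _; rewrite /g_ -mulrBl normrM ler_piMl//.
    have /andP[a b] := heaviside_itv (u x).
    have /andP[c d] := logistic_itv (k.+1%:R * u x).
    by rewrite ler_norml; apply/andP; split; lra.
apply: H10_closed => //; [by case: Lpos|by move=> i; case: (LDpos i)|].
move=> e e0.
have [k [fk gk]] : exists k, nsq (f_ k) < e /\ forall i, nsq (g_ i k) < e.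
  have Hn i : \forall k \near \oo, nsq (g_ i k) < e.
    have [_] := Hg i.
    move/cvgr0Pnorm_lt => /(_ e e0); apply: filterS => k.
    by rewrite ger0_norm// nsq_ge0.
  have F : \forall k \near \oo, nsq (f_ k) < e /\ forall i, nsq (g_ i k) < e.
    apply: filterI.
      move/cvgr0Pnorm_lt : cf => /(_ e e0); apply: filterS => k.
      by rewrite ger0_norm// nsq_ge0.
    exact: filter_forall Hn.
  by case: F => N _ /(_ N (leqnn N)); exists N.
exists (softplus k.+1%:R \o u), (fun i x => logistic (k.+1%:R * u x) * Du i x).
split.
- exact: H10_softplus.
- exact: L2pair_softplus.
- by split; [exact: (Lf k)|exact: fk].
- by move=> i; case: (Hg i) => Lg _; split; [exact: (Lg k)|exact: gk].
Qed.

End positive_part.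

(** * Weak solutions and the comparison principle *)

Section weak_formulation.
Context {R : realType} {n : nat} (Omega : set 'rV[R]_n).
Local Notation leb := (@lebesgue_rV R n).
Local Notation L2 := (L2 leb Omega).
Local Notation nsq := (nsq leb Omega).
Hypothesis oO : open Omega.
Implicit Types (f h : 'rV[R]_n -> R) (Du Dv : 'I_n -> 'rV[R]_n -> R).

Let mO : measurable Omega. Proof. exact: open_measurable_rV. Qed.

Lemma H1_L2pair (u : H1 Omega) : L2pair Omega u (grad u).
Proof.
split; first by apply/(L2P leb mO); exact: H1val_L2.
by move=> i; apply/(L2P leb mO); exact: grad_L2.
Qed.

(** Makes such pairs admissible in [weak_solution], which is tested against elements of [H1]. *)
Lemma H10_H1 (f : 'rV[R]_n -> R) Du : L2pair Omega f Du -> H10 Omega f Du ->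
  exists2 w : H1 Omega, H1val w = f & grad w = Du.
Proof.
move=> Lf Hf; have [L LD] := Lf.
have h1 : in_Lp Omega 2%:E f by apply/(L2P leb mO).
have h2 i : in_Lp Omega 2%:E (Du i) by apply/(L2P leb mO).
by exists (MkH1 h1 h2 (fun i phi tphi => H10_weak_gradient oO i Lf Hf tphi)).
Qed.

Lemma has_trace_sub h (u v : H1 Omega) : measurable_fun Omega h ->
  (forall i, measurable_fun Omega (partial i h)) ->
  has_trace h u -> has_trace h v ->
  H10 Omega (u \- v) (fun i => grad u i \- grad v i).
Proof.
move=> mh mDh Hu Hv.
have [[mu _] LDu] := H1_L2pair u; have [[mv _] LDv] := H1_L2pair v.
have mDu i : measurable_fun Omega (grad u i) by case: (LDu i).
have mDv i : measurable_fun Omega (grad v i) by case: (LDv i).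
have := H10B oO (measurable_funB mu mh) (fun i => measurable_funB (mDu i) (mDh i))
  (measurable_funB mv mh) (fun i => measurable_funB (mDv i) (mDh i)) Hu Hv.
have -> : ((u \- h) \- (v \- h)) = (u \- v) :> ('rV[R]_n -> R).
  by apply/funext => x /=; rewrite opprB addrA subrK.
congr H10; apply/funext => i; apply/funext => x /=.
by rewrite opprB addrA subrK.
Qed.

Lemma L2pair_sub (u v : H1 Omega) :
  L2pair Omega (u \- v) (fun i => grad u i \- grad v i).
Proof.
have [Lu LDu] := H1_L2pair u; have [Lv LDv] := H1_L2pair v.
by split => [|i]; [case: (nsqB mO Lu Lv)|case: (nsqB mO (LDu i) (LDv i))].
Qed.

(** The value [1 / 2] of [heaviside] at [0] is why this is an inequality; [0 <= heaviside t <= 1] is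
    enough for it. *)
Lemma heaviside_sqr_le (t y : R) :
  (heaviside t * y) ^+ 2 <= y * (heaviside t * y).
Proof.
have /andP[h0 h1] := heaviside_itv t; rewrite -subr_ge0.
have -> : y * (heaviside t * y) - (heaviside t * y) ^+ 2 =
  heaviside t * (1 - heaviside t) * y ^+ 2 by ring.
by rewrite mulr_ge0 ?sqr_ge0// mulr_ge0// subr_ge0.
Qed.

Variables (a : 'rV[R]_n -> R) (K0 K1 : R).
Hypothesis ma : measurable_fun Omega a.
Hypothesis aK : forall x, Omega x -> K0 < a x < K1.
Hypothesis K00 : 0 < K0.

Lemma energy_integrable Du Dv : (forall i, L2 (Du i)) -> (forall i, L2 (Dv i)) ->
  leb.-integrable Omega (EFin \o (fun x => a x * \sum_(i < n) Du i x * Dv i x)).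
Proof.
move=> LDu LDv.
have aC x : Omega x -> `|a x| <= K1.
  by move=> /aK/andP[a0 a1]; rewrite ger0_norm ltW// (lt_trans K00).
have H i : leb.-integrable Omega (EFin \o ((a \* Du i) \* Dv i)).
  by apply: (L2_mul_integrable mO _ (LDv i)); exact: (L2_mulb mO ma (LDu i) aC).
have := integrable_sum mO (index_enum 'I_n) (P := xpredT) (fun i _ => H i).
apply: eq_integrable => // x _ /=; rewrite sumEFin; congr EFin.
by rewrite mulr_sumr; apply: eq_bigr => i _; rewrite mulrA.
Qed.

(** The two equations are tested with the same function and subtracted. Integrability of the
    reaction terms comes with the notion of weak solution, so [F] and [G] stay arbitrary. *)
Lemma weak_solution_energy h F G (u v : H1 Omega) phi Dphi :
  weak_solution a F h u -> weak_solution a G h v ->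
  L2pair Omega phi Dphi -> H10 Omega phi Dphi ->
  leb.-integrable Omega (EFin \o (fun x => (G x - F x) * phi x)) /\
  \int[leb]_(x in Omega)
    (a x * \sum_(i < n) (grad u i x - grad v i x) * Dphi i x) =
  \int[leb]_(x in Omega) ((G x - F x) * phi x).
Proof.
move=> [_ Su] [_ Sv] Lphi Hphi.
have [w wE DwE] := H10_H1 Lphi Hphi.
have Hw : H10 Omega w (grad w) by rewrite wE DwE.
have [iF eF] := Su _ Hw; have [iG eG] := Sv _ Hw; rewrite wE in iF eF iG eG.
rewrite DwE in eF eG.
have [_ LDu] := H1_L2pair u; have [_ LDv] := H1_L2pair v; have [_ LDphi] := Lphi.
have iu := energy_integrable LDu LDphi; have iv := energy_integrable LDv LDphi.
have iGF : leb.-integrable Omega (EFin \o (fun x => (G x - F x) * phi x)).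
  have := integrableB mO iG iF; apply: eq_integrable => // x _ /=.
  by rewrite mulrBl.
split => //.
transitivity (\int[leb]_(x in Omega) (a x * \sum_(i < n) grad u i x * Dphi i x) -
   \int[leb]_(x in Omega) (a x * \sum_(i < n) grad v i x * Dphi i x)).
  rewrite -RintegralB//; apply: eq_Rintegral => x _.
  rewrite -mulrBr -sumrB; congr (_ * _); apply: eq_bigr => i _.
  by rewrite mulrBl.
rewrite eF eG opprK addrC -RintegralB//.
by apply: eq_Rintegral => x _; rewrite mulrBl.
Qed.

(** The pointwise hypothesis covers both uses, [Dphi = Dw] and [Dphi = heaviside * Dw]. One
    component suffices, Poincare's inequality needing a single direction. *)
Lemma energy_lower Dw Dphi j : (forall i, L2 (Dw i)) -> (forall i, L2 (Dphi i)) ->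
  (forall i x, Dphi i x ^+ 2 <= Dw i x * Dphi i x) ->
  K0 * nsq (Dphi j) <=
  \int[leb]_(x in Omega) (a x * \sum_(i < n) Dw i x * Dphi i x).
Proof.
move=> LDw LDphi DD; have [_ ij] := LDphi j.
rewrite /nsq -RintegralZl//; apply: le_Rintegral => //.
- by have := integrableZl mO K0 ij; apply: eq_integrable.
- exact: energy_integrable.
move=> x /aK/andP[a0 _].
have D0 i : 0 <= Dw i x * Dphi i x by rewrite (le_trans _ (DD i x)) ?sqr_ge0.
apply: (@le_trans _ _ (K0 * \sum_(i < n) Dw i x * Dphi i x)).
  rewrite ler_pM2l// (bigD1 j)//= (le_trans (DD j x))// lerDl.
  by apply: sumr_ge0 => i _.
by apply: ler_wpM2r; [apply: sumr_ge0 => i _|exact: ltW].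
Qed.

(** Tested with the positive part of [u - v], the difference of the equations has nonpositive
    right-hand side, so the positive part vanishes. The reactions are compared only where [v < u],
    which lets their monotonicity in the unknown be used. *)
Lemma comparison (M : R) (j : 'I_n) h F G (u v : H1 Omega) :
  (forall x, Omega x -> `|x 0 j| <= M) ->
  measurable_fun Omega h -> (forall i, measurable_fun Omega (partial i h)) ->
  weak_solution a F h u -> weak_solution a G h v ->
  (\forall x \ae leb, Omega x -> v x < u x -> G x <= F x) ->
  \forall x \ae leb, Omega x -> u x <= v x.
Proof.
move=> OM mh mDh Su Sv FG.
have Hw := has_trace_sub mh mDh Su.1 Sv.1.
have Lw := L2pair_sub u v.
have Lphi := L2pair_pos oO Lw; have Hphi := H10_pos oO Lw Hw.
have [iGF E] := weak_solution_energy Su Sv Lphi Hphi.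
have P := H10_poincare oO OM Lphi Hphi.
have : K0 * nsq (fun x => heaviside (u x - v x) * (grad u j x - grad v j x)) <= 0.
  have [_ LDw] := Lw; have [_ LDphi] := Lphi.
  apply: (le_trans (energy_lower j LDw LDphi _)).
    by move=> i x; exact: heaviside_sqr_le.
  rewrite [leLHS]E -oppr_ge0.
  have -> : - (\int[leb]_(x in Omega) ((G x - F x) * Num.max ((u \- v) x) 0)) =
      \int[leb]_(x in Omega) (- 1 * ((G x - F x) * Num.max ((u \- v) x) 0)).
    by rewrite RintegralZl// mulN1r.
  apply: ae_Rintegral_ge0 => //.
    by have := integrableZl mO (-1) iGF; apply: eq_integrable.
  apply: filterS FG => x FG Ox /=; rewrite mulN1r -mulNr opprB.
  have [uv|uv] := leP (u x - v x) 0; first by rewrite mulr0.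
  by apply: mulr_ge0; [rewrite subr_ge0 FG// -subr_gt0|exact: ltW].
rewrite pmulr_rle0// => D0.
have N0 : nsq (fun x => Num.max ((u \- v) x) 0) <= 0.
  apply: (le_trans P); apply: mulr_ge0_le0; last exact: D0.
  by rewrite mulr_ge0 ?sqr_ge0.
have := nsq_eq0 mO Lphi.1 N0; apply: filterS => x H /H /=.
by case: (leP (u x - v x) 0) => [|uv uv0]; [rewrite subr_le0|rewrite uv0 ltxx in uv].
Qed.

End weak_formulation.

(** * Measurability and essential bounds of the coefficients and the boundary datum *)

Section coefficients.
Context {R : realType} {n : nat} (Omega : set 'rV[R]_n).
Local Notation leb := (@lebesgue_rV R n).
Hypothesis oO : open Omega.
Implicit Types f g h : 'rV[R]_n -> R.

Let mO : measurable Omega. Proof. exact: open_measurable_rV. Qed.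

Lemma lipschitz_continuous_in (V W : normedModType R) (A : set V) (f : V -> W) :
  open A -> [lipschitz f x | x in closure A] -> {in A, continuous f}.
Proof.
move=> oA [M [_ /(_ (`|M| + 1))]].
rewrite (le_lt_trans (ler_norm M)) ?ltrDl// => /(_ isT) fM x; rewrite inE => Ax.
apply/cvgrPdist_lt => e e0.
have M0 : 0 < `|M| + 1 by rewrite ltr_wpDl.
near=> y.
have Ay : A y by near: y; exact: open_nbhs_nbhs.
have xy : `|x - y| < e / (`|M| + 1).
  by near: y; apply: cvgr_dist_lt => //; rewrite divr_gt0.
have := fM (x, y) (conj (subset_closure Ax) (subset_closure Ay)).
by move=> /le_lt_trans; apply; rewrite /= mulrC -ltr_pdivlMr.
Unshelve. all: by end_near. Qed.

Lemma lipschitz_measurable f : [lipschitz f x | x in closure Omega] ->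
  measurable_fun Omega f.
Proof.
move=> lf; apply: open_continuous_measurable_rV => //.
exact: lipschitz_continuous_in lf.
Qed.

Lemma closure_continuous_measurable f : {within closure Omega, continuous f} ->
  measurable_fun Omega f.
Proof.
move=> cf; apply: open_continuous_measurable_rV => //.
rewrite -(continuous_open_subspace f oO).
exact: continuous_subspaceW (@subset_closure _ Omega) cf.
Qed.

(** Inside [Omega] the chain rule, valid as [g > 0], writes the derivative of the power of [g]
    through the continuous extension [F] of the derivative of [g]. *)
Lemma measurable_boundary_data (theta : R) g : C1_closure Omega g ->
  (forall x, Omega x -> 0 < g x) ->
  measurable_fun Omega (boundary_data theta g) /\
  forall i, measurable_fun Omega (partial i (boundary_data theta g)).
Proof.
move=> [cg dg] g0; have mg := closure_continuous_measurable cg.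
set q := 2 / (1 + theta).
have mgp r : measurable_fun Omega (fun x => g x `^ r).
  exact: (measurableT_comp (measurable_powR r) mg).
split; first exact: mgp.
move=> i; have [F cF gF] := dg i; have mF := closure_continuous_measurable cF.
apply: (eq_measurable_fun (fun x => q * g x `^ (q - 1) * F x)).
  move=> x; rewrite inE => Ox; have [dgx gFx] := gF x Ox.
  have [_ E] := is_derive_comp1 (derivableP dgx) (is_derive1_powR q (g0 x Ox)).
  by rewrite -gFx; exact: esym E.
by apply: measurable_funM => //; apply: measurable_funM.
Qed.

Lemma Linfty_bounded f : in_Lp Omega +oo%E f -> measurable_fun Omega f /\
  exists2 C : R, 0 <= C & \forall x \ae leb, Omega x -> `|f x| <= C.
Proof.
rewrite /in_Lp inE => /andP[]; rewrite inE /= => mf; rewrite inE /= /finite_norm.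
move=> Hf; split; first by apply/(measurable_restrictT _ mO).
move: Hf; rewrite unlock /=; case: ifPn => [l0 Hf|].
  pose S := ess_sup leb (abse \o (EFin \o (f \_ Omega))).
  exists (Num.max (fine S) 0); first by rewrite le_max lexx orbT.
  have := ess_sup_ge leb (abse \o (EFin \o (f \_ Omega))).
  apply: filterS => x /= + Ox; rewrite patchE mem_set// => fS.
  rewrite le_max -lee_fin fineK ?fS//.
  by rewrite fin_real//; apply/andP; split; [exact: lt_le_trans (ltNyr _) fS|exact: Hf].
(* The degenerate case of a null space: every property then holds almost everywhere. *)
rewrite -leNgt => l0 _; exists 0 => //.
exists setT; split => //; apply/eqP; rewrite eq_le measure_ge0 andbT; exact: l0.
Qed.

End coefficients.

(** * The monotone iteration *)

Section powR_facts.
Context {R : realType}.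
Implicit Types s t p : R.

Lemma powRN_anti p s t : 0 <= p -> 0 < s -> s <= t -> t `^ (- p) <= s `^ (- p).
Proof.
move=> p0 s0 st; rewrite !powRN lef_pV2 ?posrE ?powR_gt0//; last exact: lt_le_trans st.
by apply: ge0_ler_powR => //; rewrite nnegrE ltW// (lt_le_trans s0).
Qed.

(** For positive [r], [r^(-p) r = r^(1 - p)] with a nonnegative exponent. *)
Lemma powRN_mul_mono p s t : p <= 1 -> 0 < s -> s <= t ->
  s `^ (- p) * s <= t `^ (- p) * t.
Proof.
move=> p1 s0 st; have t0 := lt_le_trans s0 st.
have E r : 0 < r -> r `^ (- p) * r = r `^ (1 - p).
  move=> r0; have c : (1 - p == 0) ==> (r != 0) by rewrite (gt_eqF r0) implybT.
  by rewrite (powRD c) powRr1 ?ltW// mulrC.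
rewrite !E//; apply: ge0_ler_powR; rewrite ?subr_ge0// nnegrE ltW//.
Qed.

(** The left side is at most [1] for [t <= 1] and at most [t] beyond. *)
Lemma powRN_mul_le p t : 0 <= p <= 1 -> 0 < t -> t `^ (- p) * t <= 1 + t.
Proof.
move=> /andP[p0 p1] t0; have [t1|t1] := leP t 1.
  have := powRN_mul_mono p1 t0 t1; rewrite powR1 mulr1 => /le_trans; apply.
  by rewrite lerDl ltW.
have := powRN_anti p0 ltr01 (ltW t1); rewrite powR1 => H.
by rewrite (le_trans (ler_wpM2r (ltW t0) H))// mul1r lerDr.
Qed.

End powR_facts.

Lemma ae_and d (T : measurableType d) (R : realType)
    (mu : {measure set T -> \bar R}) (P Q : T -> Prop) :
  (\forall x \ae mu, P x) -> (\forall x \ae mu, Q x) ->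
  \forall x \ae mu, P x /\ Q x.
Proof. by apply: filterS2 => x. Qed.

Section monotone_iteration.
Context {R : realType} {d : nat} (Omega : set 'rV[R]_d).
Local Notation leb := (@lebesgue_rV R d).
Hypothesis oO : open Omega.
Let mO : measurable Omega. Proof. exact: open_measurable_rV. Qed.

Variables (a b c h : 'rV[R]_d -> R) (K0 K1 M theta : R) (j0 : 'I_d).
Hypothesis K00 : 0 < K0.
Hypothesis ma : measurable_fun Omega a.
Hypothesis aK : forall x, Omega x -> K0 < a x < K1.
Hypothesis OM : forall x, Omega x -> `|x 0 j0| <= M.
Hypothesis fO : (leb Omega < +oo)%E.
Hypothesis mh : measurable_fun Omega h.
Hypothesis mDh : forall i, measurable_fun Omega (partial i h).
Hypothesis b0 : nonneg_ae Omega b.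
Hypothesis c0 : nonneg_ae Omega c.
Hypothesis cL : in_Lp Omega +oo%E c.
Hypothesis htheta : -1 < theta < 0.
Variable Psi : H1 Omega.
Hypothesis SPsi : weak_solution a (semilinear_term theta b c Psi) h Psi.
Hypothesis Psi_gt0 : pos_ae Omega Psi.
Variable P_ : nat -> H1 Omega.
Hypothesis SP0 : weak_solution a (b \* P_ 0) h (P_ 0).
Hypothesis SPS : forall m,
  weak_solution a (linearized_term theta b c (P_ m) (P_ m.+1)) h (P_ m.+1).

(** From [0 <= p] the coefficient [t^(-p)] is nonincreasing; from [p <= 1] the reaction [t^(1 - p)]
    is nondecreasing. *)
Let p := 1 + theta.
Let p01 : 0 <= p <= 1.
Proof. by rewrite /p; case/andP: htheta => ? ?; apply/andP; split; lra. Qed.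
Let p0 : 0 <= p. Proof. by case/andP: p01. Qed.
Let p1 : p <= 1. Proof. by case/andP: p01. Qed.

Let semiE (u : 'rV[R]_d -> R) x : 0 < u x ->
  semilinear_term theta b c u x = b x * u x + c x * (u x `^ (- p) * u x).
Proof. by move=> u0; rewrite /semilinear_term gtr0_norm. Qed.

Let linE (w u : 'rV[R]_d -> R) x :
  linearized_term theta b c w u x = b x * u x + c x * (w x `^ (- p) * u x).
Proof. by rewrite /linearized_term /p mulrA [theta + 1]addrC. Qed.

Let cmp u v F G := @comparison R d Omega oO a K0 K1 ma aK K00 M j0 h F G u v OM mh mDh.

Lemma iterate_ge m : \forall x \ae leb, Omega x -> Psi x <= P_ m x.
Proof.
elim: m => [|m IH].
  apply: (cmp SPsi SP0); move: b0 c0 Psi_gt0; apply: filterS3 => x bx cx Px Ox.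
  rewrite (semiE (Px Ox)) /= => /ltW v; rewrite -[leLHS]addr0 lerD//.
    exact: ler_wpM2l (bx Ox) _ _ v.
  by rewrite mulr_ge0 ?mulr_ge0 ?powR_ge0 ?cx// ltW// Px.
apply: (cmp SPsi (SPS m)).
have := ae_and IH b0; move: c0 Psi_gt0; apply: filterS3 => x cx Px [IHx bx] Ox.
rewrite (semiE (Px Ox)) linE => /ltW v; apply: lerD; first exact: ler_wpM2l (bx Ox) _ _ v.
(* The unknown is changed before the coefficient, since [Psi] is known to be positive while the sign
   of [P_ m.+1] is not yet available. *)
apply: ler_wpM2l (cx Ox) _ _ _; apply: (@le_trans _ _ (P_ m x `^ (- p) * Psi x)).
  by apply: ler_wpM2l v; exact: powR_ge0.
apply: ler_wpM2r; first by rewrite ltW// Px.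
by apply: powRN_anti => //; [exact: Px|exact: IHx].
Qed.

Lemma iterate_gt0 m : \forall x \ae leb, Omega x -> 0 < P_ m x.
Proof.
move: (iterate_ge m) Psi_gt0; apply: filterS2 => x Hx Px Ox.
by rewrite (lt_le_trans (Px Ox))// Hx.
Qed.

(** By induction, a smaller iterate makes the next coefficient larger and the next iterate smaller.
    At the start the equations with and without [c] are compared; the sign of that term comes from
    [iterate_gt0]. *)
Lemma iterate_decr m : \forall x \ae leb, Omega x -> P_ m.+1 x <= P_ m x.
Proof.
elim: m => [|m IH].
  apply: (cmp (SPS 0) SP0); have := ae_and b0 c0.
  move: (iterate_gt0 1); apply: filterS2 => x Px [bx cx] Ox.
  rewrite linE => /ltW v; rewrite -[leLHS]addr0; apply: lerD.
    exact: ler_wpM2l (bx Ox) _ _ v.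
  by rewrite mulr_ge0 ?mulr_ge0 ?powR_ge0 ?cx// ltW// Px.
apply: (cmp (SPS m.+1) (SPS m)).
have := ae_and b0 c0; move: (iterate_gt0 m.+1) IH; apply: filterS3 => x Px IHx [bx cx] Ox.
rewrite !linE => /ltW v; apply: lerD; first exact: ler_wpM2l (bx Ox) _ _ v.
apply: ler_wpM2l (cx Ox) _ _ _.
apply: (@le_trans _ _ (P_ m.+1 x `^ (- p) * P_ m.+1 x)).
  apply: ler_wpM2r; first by rewrite ltW// Px.
  by apply: powRN_anti => //; [exact: Px|exact: IHx].
by apply: ler_wpM2l v; exact: powR_ge0.
Qed.

(* The remainder in the equation of [P_ m.+1 - Psi], once the monotone part of
   the reaction is set apart. *)
Let defect (m : nat) x := c x *
  ((P_ m.+1 x `^ (- p) - P_ m x `^ (- p)) * P_ m.+1 x * (P_ m.+1 x - Psi x)).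

Let mP m : measurable_fun Omega (P_ m).
Proof. by case: (H1_L2pair oO (P_ m)) => -[]. Qed.

Let mPsi : measurable_fun Omega Psi.
Proof. by case: (H1_L2pair oO Psi) => -[]. Qed.

Let measurable_defect m : measurable_fun Omega (defect m).
Proof.
have [mc _] := Linfty_bounded oO cL.
have mpow k : measurable_fun Omega (fun x => P_ k x `^ (- p)).
  exact: (measurableT_comp (measurable_powR (- p)) (mP k)).
apply: measurable_funM => //; apply: measurable_funM; last exact: measurable_funB.
by apply: measurable_funM => //; exact: measurable_funB.
Qed.

(** The countably many exceptional null sets are merged into one, so that the whole sequence can be
    studied at a fixed [x]. *)
Let iterate_all : \forall x \ae leb, Omega x -> 0 < Psi x /\ forall m,
  Psi x <= P_ m x /\ P_ m.+1 x <= P_ m x.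
Proof.
have H1 : \forall x \ae leb, forall m, Omega x -> Psi x <= P_ m x.
  by apply/ae_foralln => m; exact: iterate_ge.
have H2 : \forall x \ae leb, forall m, Omega x -> P_ m.+1 x <= P_ m x.
  by apply/ae_foralln => m; exact: iterate_decr.
move: H1 H2 Psi_gt0; apply: filterS3 => x h1 h2 h3 Ox.
by split; [exact: h3|move=> m; split; [exact: h1|exact: h2]].
Qed.

Lemma energy_le_defect m j : leb.-integrable Omega (EFin \o defect m) ->
  K0 * nsq leb Omega (fun x => grad (P_ m.+1) j x - grad Psi j x) <=
  \int[leb]_(x in Omega) defect m x.
Proof.
move=> idef; have Lw := L2pair_sub oO (P_ m.+1) Psi; have [_ LDw] := Lw.
have Hw := has_trace_sub oO mh mDh (SPS m).1 SPsi.1.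
have [iGF E] := weak_solution_energy oO ma aK K00 (SPS m) SPsi Lw Hw.
apply: (le_trans (energy_lower oO ma aK K00 j LDw LDw _)).
  by move=> i x /=; rewrite expr2.
rewrite [leLHS]E; apply: ae_le_Rintegral => //.
have := ae_and b0 c0; move: iterate_all; apply: filterS2 => x Hx [bx cx] Ox.
have [P0 /(_ m)[_ _]] := Hx Ox; have [_ /(_ m.+1)[uP _]] := Hx Ox.
have bx0 := bx Ox; have cx0 := cx Ox.
rewrite semiE// linE /defect /=.
have H := powRN_mul_mono p1 P0 uP.
set u := P_ m.+1 x in uP H *; set v := Psi x in P0 uP H *.
(* [W] is the coefficient actually present in the equation of [u]; exchanging it for [U] produces
   the defect and leaves the monotone difference [U * u - V * v]. *)
set U := u `^ (- p) in H *; set V := v `^ (- p) in H *; set W := P_ m x `^ (- p).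
have Wuv : 0 <= u - v by rewrite subr_ge0.
have A : 0 <= b x * ((u - v) * (u - v)) by rewrite !mulr_ge0.
have B : 0 <= c x * ((U * u - V * v) * (u - v)) by rewrite !mulr_ge0// subr_ge0.
rewrite -subr_ge0.
have -> : c x * ((U - W) * u * (u - v)) - (b x * v + c x * (V * v) -
   (b x * u + c x * (W * u))) * (u - v) =
   b x * ((u - v) * (u - v)) + c x * ((U * u - V * v) * (u - v)) by ring.
exact: addr_ge0.
Qed.

Lemma defect_cvg : (forall m, leb.-integrable Omega (EFin \o defect m)) /\
  \int[leb]_(x in Omega) defect m x @[m --> \oo] --> 0.
Proof.
have [mc [C C0 cC]] := Linfty_bounded oO cL.
have [[mP0 iP0] _] := H1_L2pair oO (P_ 0).
(* Here [(U - W) u <= U u <= 1 + u] and [u - v <= u]; then [(1 + u) u <= 1 + 2 u^2], and [u] is at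
   most the initial iterate. *)
pose B x := C * (1 + 2 * P_ 0 x ^+ 2).
have iB : leb.-integrable Omega (EFin \o B).
  have i1 : leb.-integrable Omega (EFin \o (fun=> 1)).
    apply: measurable_bounded_integrable => //.
    by exists 1; split; [exact: num_real|move=> y y1 x _ /=; rewrite normr1 ltW].
  have := integrableZl mO C (integrableD mO i1 (integrableZl mO 2 iP0)).
  by apply: eq_integrable.
have Hle : \forall x \ae leb, forall m, Omega x -> `|defect m x| <= B x.
  move: iterate_all cC c0; apply: filterS3 => x Hx cCx cx m Ox.
  have [P0 Pm] := Hx Ox.
  have Pdec k : P_ k x <= P_ 0 x.
    by elim: k => // k; apply: le_trans; case: (Pm k).
  have [_ dm] := Pm m; have [uP _] := Pm m.+1; have [vP _] := Pm m.
  have u0 : 0 < P_ m.+1 x := lt_le_trans P0 uP.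
  have A := powRN_anti p0 u0 dm.
  have D := powRN_mul_le p01 u0.
  have W0 := powR_ge0 (P_ m x) (- p).
  have := Pdec m.+1; rewrite /defect /B.
  set u := P_ m.+1 x in uP u0 A D dm *; set U := u `^ (- p) in A D *.
  set W := P_ m x `^ (- p) in A W0 *; set v := Psi x in P0 uP vP *.
  set z := P_ 0 x => uz.
  have q0 : 0 <= (U - W) * u * (u - v).
    by rewrite !mulr_ge0 ?subr_ge0// ltW.
  have q1 : (U - W) * u * (u - v) <= 1 + 2 * z ^+ 2.
    apply: (@le_trans _ _ ((1 + u) * u)).
      apply: ler_pM; rewrite ?mulr_ge0 ?subr_ge0 ?(ltW u0)//.
        by apply: le_trans D; apply: ler_wpM2r; [exact: ltW|rewrite gerBl].
      by rewrite gerBl ltW.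
    have zu : u ^+ 2 <= z ^+ 2 by rewrite ler_sqr ?nnegrE ?(ltW u0)// (le_trans (ltW u0)).
    have := sqr_ge0 (1 - u); lra.
  rewrite normrM (ger0_norm q0); apply: ler_pM => //.
  exact: cCx.
have Hcv : \forall x \ae leb, Omega x -> defect m x @[m --> \oo] --> 0.
  move: iterate_all c0; apply: filterS2 => x Hx cx Ox.
  have [P0 Pm] := Hx Ox; have c0x := cx Ox.
  pose q (m : nat) := P_ m x `^ (- p).
  have Pgt m : 0 < P_ m x by rewrite (lt_le_trans P0)//; case: (Pm m).
  have qmono : nondecreasing_seq q.
    apply/nondecreasing_seqP => k; apply: powRN_anti => //.
    by case: (Pm k).
  have qub : has_ubound (range q).
    exists (Psi x `^ (- p)) => _ [k _ <-]; apply: powRN_anti => //.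
    by case: (Pm k).
  have /cvg_ex[l ql] := nondecreasing_is_cvgn qmono qub.
  (* The increments of the convergent sequence [q] tend to [0], and their prefactor does not depend
     on [m]. *)
  have dq : (c x * (P_ 0 x * P_ 0 x)) * (q m.+1 - q m) @[m --> \oo] --> 0.
    rewrite -[X in _ --> X](mulr0 (c x * (P_ 0 x * P_ 0 x))).
    apply: cvgM; first exact: cvg_cst.
    rewrite -[X in _ --> X](subrr l); apply: cvgB => //.
    by have := ql; rewrite -cvg_shiftS.
  apply: (squeeze_cvgr _ (cvg_cst 0) dq); apply: nearW => m.
  have Pdec k : P_ k x <= P_ 0 x.
    by elim: k => // k; apply: le_trans; case: (Pm k).
  have qm : 0 <= q m.+1 - q m by rewrite subr_ge0; exact: qmono.
  have uP : Psi x <= P_ m.+1 x by case: (Pm m.+1).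
  have w0 : 0 <= P_ m.+1 x - Psi x by rewrite subr_ge0.
  have u0 := ltW (Pgt m.+1).
  rewrite /defect -/(q m) -/(q m.+1); apply/andP; split; first by rewrite !mulr_ge0.
  have uu : P_ m.+1 x * (P_ m.+1 x - Psi x) <= P_ 0 x * P_ 0 x.
    apply: ler_pM => //.
    by rewrite (le_trans _ (Pdec m.+1))// gerBl ltW.
  rewrite -subr_ge0.
  have -> : c x * (P_ 0 x * P_ 0 x) * (q m.+1 - q m) -
      c x * ((q m.+1 - q m) * P_ m.+1 x * (P_ m.+1 x - Psi x)) =
    c x * (q m.+1 - q m) * (P_ 0 x * P_ 0 x - P_ m.+1 x * (P_ m.+1 x - Psi x)).
    by ring.
  by rewrite !mulr_ge0// subr_ge0.
have mdef m : measurable_fun Omega (EFin \o defect m) by exact/measurable_EFinP.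
have idef m : leb.-integrable Omega (EFin \o defect m).
  apply/integrableP; split; first exact: mdef.
  move: iB => /integrableP[mB]; apply: le_lt_trans.
  apply: ae_ge0_le_integral => //.
  - exact: measurableT_comp.
  - exact: measurableT_comp.
  apply: filterS Hle => x /(_ m) H /H; rewrite lee_fin => /le_trans; apply.
  exact: ler_norm.
split => //.
have [||||_ _] := @dominated_convergence _ _ R leb Omega mO
  (fun m => EFin \o defect m) (cst 0%E) (EFin \o B) mdef.
- exact: measurable_cst.
- apply: filterS Hcv => x H /H Hx; apply/fine_cvgP; split; first exact: nearW.
  exact: Hx.
- exact: iB.
- by apply: filterS Hle => x H m /(H m); rewrite lee_fin.
by rewrite integral0 => /fine_cvgP[_].
Qed.

Lemma iterate_H1_cvg : H1_cvg P_ Psi.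
Proof.
have [idef cdef] := defect_cvg.
pose E (m : nat) := \int[leb]_(x in Omega) defect m x.
have KE m j : nsq leb Omega (fun x => grad (P_ m.+1) j x - grad Psi j x) <= E m / K0.
  by rewrite ler_pdivlMr// mulrC energy_le_defect.
(* The energy bound with index [m] concerns the iterate [m.+1], so the first term of the sequence is
   dropped. *)
rewrite /H1_cvg -cvg_shiftS /=.
(* Poincare's constant for the function, plus one unit for each of the [d] derivatives. *)
pose C := 16 * M ^+ 2 + d%:R.
have HE m : (H1sqnorm Omega (P_ m.+1 \- Psi)%R
    (fun i => grad (P_ m.+1) i \- grad Psi i)%R <= (C * (E m / K0))%:E)%E.
  have Lw := L2pair_sub oO (P_ m.+1) Psi.
  have Hw := has_trace_sub oO mh mDh (SPS m).1 SPsi.1.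
  rewrite H1sqnormE// lee_fin /C mulrDl lerD//.
    apply: (le_trans (H10_poincare oO OM Lw Hw)).
    by apply: ler_wpM2l; [rewrite mulr_ge0 ?sqr_ge0|exact: KE].
  rewrite mulr_natl -[X in _ *+ X]card_ord -sumr_const.
  by apply: ler_sum => i _; exact: KE.
have CE : (C * (E m / K0))%:E @[m --> \oo] --> 0%E.
  apply/fine_cvgP; split; first exact: nearW.
  rewrite -[X in _ --> X](mulr0 C); apply: cvgM; first exact: cvg_cst.
  by rewrite -[X in _ --> X](mul0r K0^-1); apply: cvgM; [exact: cdef|exact: cvg_cst].
apply: (squeeze_cvge _ (cvg_cst 0%E) CE); apply: nearW => m.
by rewrite HE andbT; exact: H1sqnorm_ge0.
Qed.

End monotone_iteration.

Theorem theorem5p1 (R : realType) (d : nat) (hd : d = 2%N \/ d = 3%N)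
  (Omega : set 'rV[R]_d)
  (hdom : domain Omega) (hbnd : bounded_set Omega)
  (hsc : simply_connected Omega) (hC2 : C2_boundary Omega)
  (K0 K1 : R) (hK0 : 0 < K0) (hK1 : 0 < K1)
  (a sigma g c : 'rV[R]_d -> R)
  (ha_lip : [lipschitz a x | x in closure Omega])
  (ha : forall x, closure Omega x -> K0 < a x < K1)
  (hsigma_Linfty : in_Lp Omega +oo%E sigma)
  (hsigma : \forall x \ae @lebesgue_rV R d, Omega x -> K0 < sigma x < K1)
  (hg_C1 : C1_closure Omega g)
  (hg : forall x, closure Omega x -> K0 < g x < K1)
  (hc_Linfty : in_Lp Omega +oo%E c)
  (theta mu : R) (htheta : -1 < theta < 0)
  (hb : nonneg_ae Omega (b_coef theta mu sigma)) (hc : nonneg_ae Omega c)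
  (g0 : R)
  (hg0 : positivity_threshold Omega theta a (b_coef theta mu sigma) c g0)
  (hgg0 : forall x, boundary Omega x -> g0 < g x)
  (Psi_ : nat -> H1 Omega)
  (hPsi_0 : weak_solution a (b_coef theta mu sigma \* Psi_ 0%N)
              (boundary_data theta g) (Psi_ 0%N))
  (hPsi_S : forall n : nat, (1 <= n)%N ->
     weak_solution a
       (linearized_term theta (b_coef theta mu sigma) c (Psi_ n.-1) (Psi_ n))
       (boundary_data theta g) (Psi_ n)) :
  exists Psi : H1 Omega,
    unique_H1 (fun u : H1 Omega =>
      semilinear_solution theta a (b_coef theta mu sigma) c g u /\
      pos_ae Omega u) Psi /\
    H1_cvg Psi_ Psi.
Proof.
have [oO _ [x0 Ox0]] := hdom.
have mO := open_measurable_rV oO.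
have sub x : Omega x -> closure Omega x := @subset_closure _ Omega x.
have [g0_gt0 /(_ g hg_C1)] := hg0.
have gpos x : closure Omega x -> 0 < g x.
  by move=> /hg/andP[+ _]; exact: lt_trans.
move=> /(_ gpos hgg0)[Psi [[[SPsi Psi_ge0] Psi_uniq] Psi_gt0]].
exists Psi; split.
  (* The threshold gives uniqueness among nonnegative solutions, which include the positive ones. *)
  split; first by split.
  move=> v [Sv v_gt0]; apply: Psi_uniq; split => //.
  by apply: filterS v_gt0 => x vx Ox; exact/ltW/vx.
have [mh mDh] := measurable_boundary_data oO theta hg_C1 (fun x Ox => gpos x (sub x Ox)).
have [M OM] : exists M : R, forall x, Omega x -> `|x| <= M.
  by have [M [_ /(_ (M + 1))]] := hbnd; rewrite ltrDl ltr01 => /(_ isT) HM; exists (M + 1).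
(* Any direction will do for Poincare's inequality; one exists because [d] is nonzero. *)
have [j0 _] : exists j : 'I_d, True by case: hd => ->; exists ord0.
have aO x : Omega x -> K0 < a x < K1 by move=> /sub/ha.
have fO := lebesgue_rV_bounded mO hbnd.
apply: (@iterate_H1_cvg R d Omega oO a (b_coef theta mu sigma) c
  (boundary_data theta g) K0 K1 M theta j0) => //.
- exact: lipschitz_measurable.
- by move=> x /OM; apply: le_trans; exact: ler_norm_coord.
- by move=> m; exact: (hPsi_S m.+1).
Qed.
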